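(* Let $\tau\ge1$, $\widetilde T=(t_1,\dots,t_\tau)$ and $p\in\{\infty,\omega\}$. If $f=\mathcal I(F)\in\mathcal S^p_T(\Omega_D,A)$, then there exists $g\in\mathcal S^p_T(\Omega_D,A)$ such that \[\overline\partial_{\widetilde T}f=\overline\partial_Tf+(1+t_0-t_1)g,\qquad \partial_{\widetilde T}f=\partial_Tf+(t_1-t_0-1)g\] (so that $\overline\partial_{\widetilde T}f,\partial_{\widetilde T}f\in\mathcal S^p_T(\Omega_D,A)$). For every $K\subseteq\{1,\dots,\tau\}$, the $K$-component of the $T$-stem function $G\in\mathrm{Stem}^p_T(D,A\otimes\mathbb R^{2^\tau})$ inducing $g$ satisfies $G_K(\alpha,\beta)=\beta_1^{-1}F_{\{1\}\cup K}(\alpha,\beta)$ if $1\notin K$ and $G_K(\alpha,\beta)=0$ if $1\in K$, for all $(\alpha,\beta)\in D'=\{(\alpha,\beta_1,\dots,\beta_\tau)\in D:\beta_1\ne0\}$.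
   Context: $A$ is a finite-dimensional associative real algebra with unit and a $*$-involution $x\mapsto x^c$; $\mathbb S_A=\{x:x+x^c=0,xx^c=1\}\ne\emptyset$. $V\subseteq A$ has basis $(v_0=1,v_1,\dots,v_N)$, $N\ge1$, $v_s\in\mathbb S_A$ pairwise anticommuting for $s\ge1$, $V\subseteq\bigcup_{J\in\mathbb S_A}(\mathbb R+J\mathbb R)$; $A$ carries the Euclidean norm making a completion of this basis orthonormal. $\mathbb R_{\ell,m}=\mathrm{Span}_{\mathbb R}(v_\ell,\dots,v_m)$, $\mathbb S_{\ell,m}$ its unit sphere. A list of steps $T=(t_0,\dots,t_\tau)$, $0\le t_0<\dots<t_\tau=N$, with torus $\mathbb T=\mathbb S_{t_0+1,t_1}\times\cdots\times\mathbb S_{t_{\tau-1}+1,t_\tau}$ (for $0$ steps: single index $J=\emptyset$). For $J\in\mathbb T$, $\beta\in\mathbb R^\tau$: $\beta J=\sum\beta_hJ_h$; $J_\emptyset=1$, $J_K=J_{k_1}\cdots J_{k_p}$; $\overline\beta^h$ flips the sign of $\beta_h$; $\sigma(h,K)$ is the parity of $\#\{k\in K:k\le h\}$. $D\subseteq\mathbb R_{0,t_0}\times\mathbb R^\tau$ open, reflection invariant, $\Omega_D=\{\alpha+\beta J\}$ open. $T$-stem functions $F=\sum_KE_KF_K$ ($F_K(\alpha,\overline\beta^h)=F_K$ if $h\notin K$, $-F_K$ if $h\in K$) induce $\mathcal I(F)(\alpha+\beta J)=\sum_KJ_KF_K(\alpha,\beta)$ ($\mathcal I$ injective); $\mathrm{Stem}^p_T,\mathcal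 S^p_T$ their $C^p$ versions. Operators on stems: with $\alpha=\sum_{s\le t_0}x_sv_s$, partial derivatives $\partial_{\alpha_s}$ (in $x_s$) and $\partial_{\beta_h}$, $\overline\partial^u_\alpha=\partial_{\alpha_0}-(-1)^u\sum_{s=1}^{t_0}v_s\partial_{\alpha_s}$; $(\overline\partial_TF)_K=\overline\partial^{|K|+1}_\alpha F_K+\sum_h(-1)^{\sigma(h,K)+1}\partial_{\beta_h}F_{K\triangle\{h\}}$, $(\partial_TF)_K=\overline\partial^{|K|}_\alpha F_K+\sum_h(-1)^{\sigma(h,K)}\partial_{\beta_h}F_{K\triangle\{h\}}$, and on $T$-functions $\overline\partial_T\mathcal I(F)=\mathcal I(\overline\partial_TF)$, $\partial_T\mathcal I(F)=\mathcal I(\partial_TF)$; the same definitions for any list of steps. $\widetilde T$ has mirror $\mathbb R_{0,t_1}$ and $\Omega_D=\Omega_{\widetilde D}$ for $\widetilde T$, with $\widetilde D=\{(\alpha+x^1,\beta_2,\dots,\beta_\tau):x^1\in\mathbb R_{t_0+1,t_1},(\alpha,\|x^1\|,\beta_2,\dots,\beta_\tau)\in D\}$; every element of $\mathcal S^p_T(\Omega_D,A)$, $p\in\{\infty,\omega\}$, is an element of $\mathcal S^p_{\widetilde T}(\Omega_D,A)$, and $\overline\partial_{\widetilde T},\partial_{\widetilde T}$ are applied in that sense. *)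

(* Defs.v *)
From HB Require Import structures.
From mathcomp Require Import all_boot all_order all_algebra falgebra.
From mathcomp Require Import all_classical all_reals all_analysis.
Set Implicit Arguments. Unset Strict Implicit. Unset Printing Implicit Defensive.
Import Order.TTheory GRing.Theory Num.Theory.
Import numFieldNormedType.Exports.
Local Open Scope ring_scope.
Local Open Scope classical_set_scope.

Inductive regularity := Cinf | Comega.

Section RealFunctions.
Variable R : realType.

Definition evec n (i : 'I_n) : 'rV[R]_n := delta_mx 0 i.

Definition pderiv n (i : 'I_n) (phi : 'rV[R]_n -> R) : 'rV[R]_n -> R :=
  fun x => 'D_(evec i) phi x.

Definition iter_pderiv n (l : seq 'I_n) (phi : 'rV[R]_n -> R) :=
  foldr (fun i g => pderiv i g) phi l.

Definition smooth_on n (D : set 'rV[R]_n) (phi : 'rV[R]_n -> R) :=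
  forall (l : seq 'I_n) x, D x ->
    {for x, continuous (iter_pderiv l phi)} /\
    forall i, derivable (iter_pderiv l phi) x (evec i).

Definition monom n (a : {ffun 'I_n -> nat}) (y : 'rV[R]_n) : R :=
  \prod_(i < n) (y 0 i) ^+ a i.

Definition mi n k (a : {ffun 'I_n -> 'I_k.+1}) : {ffun 'I_n -> nat} :=
  [ffun i => (a i : nat)].

Definition deg_part n (c : {ffun 'I_n -> nat} -> R) (y : 'rV[R]_n) k : R :=
  \sum_(a : {ffun 'I_n -> 'I_k.+1} | (\sum_i (a i : nat) == k)%N)
     c (mi a) * monom (mi a) y.
Definition abs_deg_part n (c : {ffun 'I_n -> nat} -> R) (y : 'rV[R]_n) k : R :=
  \sum_(a : {ffun 'I_n -> 'I_k.+1} | (\sum_i (a i : nat) == k)%N)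
     `|c (mi a)| * `|monom (mi a) y|.

Definition analytic_on n (D : set 'rV[R]_n) (phi : 'rV[R]_n -> R) :=
  forall x0, D x0 -> exists2 r : R, 0 < r &
    exists c : {ffun 'I_n -> nat} -> R, forall x : 'rV[R]_n,
      (forall i, `|x 0 i - x0 0 i| < r) ->
      cvgn (fun N => \sum_(k < N) abs_deg_part c (x - x0) k) /\
      (fun N => \sum_(k < N) deg_part c (x - x0) k) @ \oo --> phi x.

Definition has_reg (p : regularity) n (D : set 'rV[R]_n) phi :=
  match p with Cinf => smooth_on D phi | Comega => analytic_on D phi end.

End RealFunctions.

Section Algebra.
Variable R : realType.
Variable A : falgType R.

(** A-valued functions: regularity and partial derivatives through the
    (linear) coordinates of the finite-dimensional space A *)
Definition acoord (j : 'I_(\dim {:A})) (x : A) : R := coord (vbasis {:A}) j x.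

Definition regA (p : regularity) n (D : set 'rV[R]_n) (F : 'rV[R]_n -> A) :=
  forall j : 'I_(\dim {:A}), has_reg p D (fun y => acoord j (F y)).

Definition pderivA n (i : 'I_n) (F : 'rV[R]_n -> A) : 'rV[R]_n -> A :=
  fun x => \sum_(j < \dim {:A}) pderiv i (fun y => acoord j (F y)) x *: (vbasis {:A})`_j.

Definition star_involution (conj : A -> A) :=
  [/\ forall (a : R) x y, conj (a *: x + y) = a *: conj x + conj y,
      forall x, conj (conj x) = x,
      forall x y, conj (x * y) = conj y * conj x &
      forall a : R, conj (a%:A) = a%:A].

Definition imag_unit (conj : A -> A) (x : A) := x + conj x = 0 /\ x * conj x = 1.

Definition basis_hyp (conj : A -> A) (N : nat) (v : nat -> A) :=
  [/\ v 0%N = 1,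
      free (mkseq v N.+1),
      forall s, (1 <= s <= N)%N -> imag_unit conj (v s),
      forall s s', (1 <= s)%N -> (s < s')%N -> (s' <= N)%N -> v s * v s' = - (v s' * v s) &
      forall x, x \in <<mkseq v N.+1>>%VS ->
        exists J, imag_unit conj J /\ exists a b : R, x = a%:A + b *: J].

Variable v : nat -> A.

(** unit sphere S_{l,m} of R_{l,m} (basis orthonormal) *)
Definition inSph (l m : nat) (x : A) :=
  exists y : nat -> R, x = \sum_(l <= s < m.+1) y s *: v s /\
                      \sum_(l <= s < m.+1) y s ^+ 2 = 1.

(** the torus of the list of steps (t_0, ..., t_tau); J h is J_{h+1} *)
Definition torus (tau : nat) (t : nat -> nat) (J : 'I_tau -> A) :=
  forall h : 'I_tau, inSph (t h).+1 (t h.+1) (J h).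

Definition JK tau (J : 'I_tau -> A) (K : {set 'I_tau}) : A :=
  \prod_(h < tau | h \in K) J h.

(** points of R_{0,t0} x R^tau are row vectors w; the alpha-coordinate
    x_s is w 0 (lshift tau s), the beta-coordinate beta_{h+1} is
    w 0 (rshift t0.+1 h) *)
Definition alpha_c t0 tau (w : 'rV[R]_(t0.+1 + tau)) (s : 'I_t0.+1) : R :=
  w 0 (lshift tau s).
Definition beta_c t0 tau (w : 'rV[R]_(t0.+1 + tau)) (h : 'I_tau) : R :=
  w 0 (rshift t0.+1 h).

Definition pt t0 tau (w : 'rV[R]_(t0.+1 + tau)) (J : 'I_tau -> A) : A :=
  \sum_(s < t0.+1) alpha_c w s *: v s + \sum_(h < tau) beta_c w h *: J h.

Definition bflip t0 tau (h : 'I_tau) (w : 'rV[R]_(t0.+1 + tau)) : 'rV[R]_(t0.+1 + tau) :=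
  \row_j (if j == rshift t0.+1 h then - w 0 j else w 0 j).

Definition refl_inv t0 tau (D : set 'rV[R]_(t0.+1 + tau)) :=
  forall h w, D w -> D (bflip h w).

Definition is_stem t0 tau (D : set 'rV[R]_(t0.+1 + tau))
  (F : {set 'I_tau} -> 'rV[R]_(t0.+1 + tau) -> A) :=
  forall K h w, D w -> F K (bflip h w) = if h \in K then - F K w else F K w.

Definition stem_reg (p : regularity) t0 tau (D : set 'rV[R]_(t0.+1 + tau))
  (F : {set 'I_tau} -> 'rV[R]_(t0.+1 + tau) -> A) :=
  is_stem D F /\ forall K, regA p D (F K).

Definition IF_at t0 tau (J : 'I_tau -> A)
  (F : {set 'I_tau} -> 'rV[R]_(t0.+1 + tau) -> A) (w : 'rV[R]_(t0.+1 + tau)) : A :=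
  \sum_(K : {set 'I_tau}) JK J K * F K w.

Definition induces t0 tau (t : nat -> nat) (D : set 'rV[R]_(t0.+1 + tau))
  (F : {set 'I_tau} -> 'rV[R]_(t0.+1 + tau) -> A) (f : A -> A) :=
  forall w J, D w -> torus t J -> f (pt w J) = IF_at J F w.

Definition dalpha t0 tau (u : nat) (G : 'rV[R]_(t0.+1 + tau) -> A) :
  'rV[R]_(t0.+1 + tau) -> A := fun w =>
  pderivA (lshift tau ord0) G w
  - (-1) ^+ u * \sum_(s < t0.+1 | (0 < s)%N) v s * pderivA (lshift tau s) G w.

Definition sigma_par tau (h : 'I_tau) (K : {set 'I_tau}) : nat :=
  #|[set k in K | (k <= h)%N]|.

Definition symdiff1 tau (K : {set 'I_tau}) (h : 'I_tau) : {set 'I_tau} :=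
  if h \in K then K :\ h else h |: K.

Definition dbarT t0 tau (F : {set 'I_tau} -> 'rV[R]_(t0.+1 + tau) -> A) :
  {set 'I_tau} -> 'rV[R]_(t0.+1 + tau) -> A := fun K w =>
  dalpha #|K|.+1 (F K) w
  + \sum_(h < tau) (-1) ^+ (sigma_par h K).+1 * pderivA (rshift t0.+1 h) (F (symdiff1 K h)) w.

Definition dT t0 tau (F : {set 'I_tau} -> 'rV[R]_(t0.+1 + tau) -> A) :
  {set 'I_tau} -> 'rV[R]_(t0.+1 + tau) -> A := fun K w =>
  dalpha #|K| (F K) w
  + \sum_(h < tau) (-1) ^+ (sigma_par h K) * pderivA (rshift t0.+1 h) (F (symdiff1 K h)) w.

End Algebra.

(** i-th entry of a row vector (0 if out of range) *)
Definition rget (R : realType) n (w : 'rV[R]_n) (i : nat) : R :=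
  \sum_(j < n | (j : nat) == i) w 0 j.

(** the map w~ = (alpha + x^1, beta_2, ..., beta_tau) |->
    (alpha, ||x^1||, beta_2, ..., beta_tau) *)
Definition contractD (R : realType) t0 t1 tau tau' (w' : 'rV[R]_(t1.+1 + tau')) :
  'rV[R]_(t0.+1 + tau) :=
  \row_(j < t0.+1 + tau) match fintype.split j with
    | inl s => rget (lsubmx w') s
    | inr h => if (h : nat) == 0%N
               then Num.sqrt (\sum_(s < t1.+1 | (t0 < s)%N) (lsubmx w' 0 s) ^+ 2)
               else rget (rsubmx w') h.-1
    end.

Definition tildeD (R : realType) t0 t1 tau tau' (D : set 'rV[R]_(t0.+1 + tau)) :
  set 'rV[R]_(t1.+1 + tau') :=
  [set w' | D (@contractD R t0 t1 tau tau' w')].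

(* Main.v *)
Require Import Defs.
From HB Require Import structures.
From mathcomp Require Import all_boot all_order all_algebra falgebra.
From mathcomp Require Import all_classical all_reals all_analysis.
From mathcomp Require Import zify ring lra.
Set Implicit Arguments. Unset Strict Implicit. Unset Printing Implicit Defensive.
Import Order.TTheory GRing.Theory Num.Theory.
Import numFieldNormedType.Exports.
Local Open Scope ring_scope.
Local Open Scope classical_set_scope.

(** The quotient [G_K = F_{1,K} / beta_1] is regular because [F_{1,K}] is odd in
    [beta_1].  In the analytic case the quotient is read off the power series by
    shifting the exponent of one variable; in the smooth case, near
    [beta_1 = 0], it is the average of [d F / d beta_1] over the segment joining
    the point to its projection on the hyperplane, and such averages form a
    class stable under partial derivatives.

    Since the units [J_h] may be replaced by [- J_h] independently, the equality
    of the two expressions of [f] can be read componentwise, which gives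
    [Ft_K (alpha + x1, beta) = F_K (alpha, |x1|, beta) +
      (-1)^|K| x1 G_K (alpha, |x1|, beta)].
    Differentiating this in the coordinates of [x1] and summing against the [v_s]
    yields the radial derivative [J_1 d F_K / d beta_1 - ...] together with one
    copy of [G_K] for each direction orthogonal to [x1]; there are
    [t_1 - t_0 - 1] of them.  The operator [dT] is treated through
    [dT = 2 d_{alpha_0} - dbarT]. *)

(** * Power series and division by a coordinate *)

(** The conclusion compares values at two arbitrary representations of one point, while the
    computation needs a particular one: [J_1 = x1 / |x1|] and the contracted coordinates
    [(alpha, |x1|, beta_2, ...)]. Passing from one to the other is possible because [dbarT F], [G]
    and the [alpha_0]-derivative of [F] are stems again, and the value induced by a stem does not
    depend on the representation.

    The delicate points are those with [x1 = 0]: there [|x1|] is not differentiable, [J_1] is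
    arbitrary and [G] is not a quotient. Parity repairs this. For [1] outside [K] both [F_K] and
    [G_K] are even in [beta_1], so along a coordinate line an increment [|r|] of [beta_1] may be
    replaced by [r], and the [beta_1]-derivative of [F_K] vanishes. The identity
    [F_{1,K} = beta_1 G_K], free of division, treats all points at once.

    The coefficient of [G_K] does not depend on [K] because the sign [(-1)^|K|] in front of [x1 G_K]
    meets the same sign in the operator. *)

Section MultiIndex.
Variables (R : realType) (n : nat) (i : 'I_n).
Implicit Types (b c : {ffun 'I_n -> nat} -> R) (z : 'rV[R]_n).

Definition mi_incr (a : {ffun 'I_n -> nat}) : {ffun 'I_n -> nat} :=
  [ffun j => (a j + (j == i))%N].
Definition mi_decr (a : {ffun 'I_n -> nat}) : {ffun 'I_n -> nat} :=
  [ffun j => (a j - (j == i))%N].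

(** Coefficients of [z_i] times the series of [b]. The guard is there because [mi_decr] truncates
    and would fix every [a] with [a i = 0]. *)
Definition mul_coef b : {ffun 'I_n -> nat} -> R :=
  fun a => if (0 < a i)%N then b (mi_decr a) else 0.

Lemma monom_incr a z : monom (mi_incr a) z = z 0 i * monom a z.
Proof.
rewrite /monom (bigD1 i)//= [in RHS](bigD1 i)//= ffunE eqxx addn1 exprS -mulrA.
congr (_ * (_ * _)); apply: eq_bigr => j /negPf ji.
by rewrite ffunE ji addn0.
Qed.

Lemma deg_part_mul b z k : z 0 i * deg_part b z k = deg_part (mul_coef b) z k.+1.
Proof.
rewrite /deg_part [RHS](bigID (fun a : {ffun 'I_n -> 'I_k.+2} => (0 < a i)%N))/=.
rewrite [X in _ = _ + X]big1 ?addr0; last first.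
  by move=> a /andP[_ /negPf a0]; rewrite /mul_coef /mi ffunE a0 mul0r.
pose up (a : {ffun 'I_n -> 'I_k.+1}) : {ffun 'I_n -> 'I_k.+2} :=
  [ffun j => inord (a j + (j == i))].
pose dn (a : {ffun 'I_n -> 'I_k.+2}) : {ffun 'I_n -> 'I_k.+1} :=
  [ffun j => inord (a j - (j == i))].
have upE a j : up a j = (a j + (j == i))%N :> nat.
  by rewrite ffunE inordK//; have := ltn_ord (a j); case: (j == i) => /=; lia.
(* The exponents of degree [k] and [k.+1] have different ordinal bounds. Nothing is lost by [inord]:
   if the degree is [k.+1] and [a i > 0], every other exponent is at most [k]. *)
rewrite (reindex_onto up dn)/=; last first.
  move=> a /andP[/eqP sa a0]; apply/ffunP => j; apply/ord_inj.
  rewrite upE ffunE inordK; first by have [->|] := eqVneq j i => /=; lia.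
  move: sa; rewrite (bigD1 i)//=.
  have [->|ji] := eqVneq j i => /=; first by lia.
  by rewrite (bigD1 j)//=; lia.
rewrite mulr_sumr; apply: eq_big => a.
  have -> : dn (up a) == a.
    apply/eqP/ffunP => j; apply/val_inj.
    rewrite ffunE /= upE inordK; first by lia.
    by have := ltn_ord (a j); lia.
  rewrite andbT; under [in RHS]eq_bigr do rewrite upE.
  have -> : (\sum_j (a j + (j == i)) = (\sum_j a j).+1)%N.
    rewrite big_split/= -[RHS]addn1; congr addn.
    by rewrite (bigD1 i)//= eqxx big1 ?addn0// => j /negPf ->.
  by rewrite upE eqxx addn1 eqSS andbT.
move=> _; have miE : mi (up a) = mi_incr (mi a).
  by apply/ffunP => j; rewrite [LHS]ffunE upE !ffunE.
rewrite miE monom_incr /mul_coef ffunE eqxx addn1/= mulrCA; congr (b _ * _).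
by apply/ffunP => j; rewrite !ffunE addnK.
Qed.

Lemma deg_part_mul0 b z : deg_part (mul_coef b) z 0 = 0.
Proof.
rewrite /deg_part big1// => a /eqP sa; rewrite /mul_coef ffunE.
by move: sa; rewrite (bigD1 i)//=; case: (a i) => [[|m] /= _]; rewrite ?mul0r.
Qed.

Lemma deg_partD b c z k :
  deg_part (fun a => b a + c a) z k = deg_part b z k + deg_part c z k.
Proof. by rewrite /deg_part -big_split/=; apply: eq_bigr => a _; rewrite mulrDl. Qed.

Lemma deg_partZ (r : R) b z k :
  deg_part (fun a => r * b a) z k = r * deg_part b z k.
Proof. by rewrite /deg_part mulr_sumr; apply: eq_bigr => a _; rewrite mulrA. Qed.

Lemma eq_deg_part b c z k : b =1 c -> deg_part b z k = deg_part c z k.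
Proof. by move=> e; apply: eq_bigr => a _; rewrite e. Qed.

Lemma norm_monom a z : `|monom a z| = monom a (map_mx Num.norm z).
Proof.
by rewrite /monom normr_prod; apply: eq_bigr => j _; rewrite mxE normrX.
Qed.

Lemma abs_deg_partE c z k :
  abs_deg_part c z k = deg_part (fun a => `|c a|) (map_mx Num.norm z) k.
Proof. by apply: eq_bigr => a _; rewrite norm_monom. Qed.

Lemma abs_deg_part_ge0 c z k : 0 <= abs_deg_part c z k.
Proof. by apply: sumr_ge0 => a _; rewrite mulr_ge0. Qed.

Lemma norm_deg_part c z k : `|deg_part c z k| <= abs_deg_part c z k.
Proof.
rewrite (le_trans (ler_norm_sum _ _ _))//; apply: ler_sum => a _.
by rewrite normrM.
Qed.

Lemma abs_deg_part_le c z z' k : (forall j, `|z 0 j| <= `|z' 0 j|) ->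
  abs_deg_part c z k <= abs_deg_part c z' k.
Proof.
move=> zz'; apply: ler_sum => a _; apply: ler_wpM2l => //.
rewrite !normr_prod; apply: ler_prod => j _; rewrite normr_ge0 /= !normrX.
by apply: lerXn2r => //; rewrite nnegrE.
Qed.

(** [div_coef c] is the series of [(f z - f z|_{z_i = 0}) / z_i] *)
Definition div_coef c : {ffun 'I_n -> nat} -> R := fun a => c (mi_incr a).

Definition set0_at z : 'rV[R]_n := \row_j (if j == i then 0 else z 0 j).

(** The series of the restriction to [z_i = 0]. *)
Definition const_coef c : {ffun 'I_n -> nat} -> R :=
  fun a => if (0 < a i)%N then 0 else c a.

Lemma coef_decomp c a : c a = const_coef c a + mul_coef (div_coef c) a.
Proof.
rewrite /const_coef /mul_coef /div_coef; case: ifPn => [ai|]; last by rewrite addr0.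
rewrite add0r; congr c; apply/ffunP => j; rewrite !ffunE.
by have [->|_] := eqVneq j i; rewrite /= ?subnK// subn0 addn0.
Qed.

Lemma deg_part_const c z k : deg_part (const_coef c) z k = deg_part c (set0_at z) k.
Proof.
apply: eq_bigr => a _; rewrite /const_coef ffunE; case: posnP => ai.
  congr (_ * _); apply: eq_bigr => j _; rewrite !mxE.
  by case: eqP => [->|//]; rewrite ffunE ai !expr0.
rewrite mul0r /monom (bigD1 i)//= mxE eqxx ffunE expr0n gtn_eqF//=.
by rewrite mul0r mulr0.
Qed.

End MultiIndex.

Section PowerSeries.
Variables (R : realType) (n : nat).
Implicit Types (b c : {ffun 'I_n -> nat} -> R) (z : 'rV[R]_n).

Definition mpseries c z (N : nat) : R := \sum_(k < N) deg_part c z k.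
Definition abs_mpseries c z (N : nat) : R := \sum_(k < N) abs_deg_part c z k.

Lemma nondecreasing_abs_mpseries c z : nondecreasing_seq (abs_mpseries c z).
Proof.
apply/nondecreasing_seqP => N; rewrite /abs_mpseries big_ord_recr/= lerDl.
exact: abs_deg_part_ge0.
Qed.

Lemma abs_mpseries_cvgP c z (M : R) :
  (forall N, abs_mpseries c z N <= M) -> cvgn (abs_mpseries c z).
Proof.
move=> bM; apply: (nondecreasing_is_cvgn (nondecreasing_abs_mpseries c z)).
by exists M => _ [N _ <-].
Qed.

Lemma abs_mpseries_le_lim c z N : cvgn (abs_mpseries c z) ->
  abs_mpseries c z N <= limn (abs_mpseries c z).
Proof. by move=> cv; apply: nondecreasing_cvgn_le => //; exact: nondecreasing_abs_mpseries. Qed.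

Lemma abs_mpseries_cvg_le c z z' : (forall j, `|z 0 j| <= `|z' 0 j|) ->
  cvgn (abs_mpseries c z') -> cvgn (abs_mpseries c z).
Proof.
move=> zz' cv; apply: (@abs_mpseries_cvgP _ _ (limn (abs_mpseries c z'))) => N.
apply: le_trans (abs_mpseries_le_lim N cv); apply: ler_sum => k _.
exact: abs_deg_part_le.
Qed.

Lemma mpseriesE c z : mpseries c z = series (deg_part c z).
Proof. by apply/funext => N; rewrite /mpseries /series/= big_mkord. Qed.

Lemma abs_mpseriesE c z : abs_mpseries c z = series (abs_deg_part c z).
Proof. by apply/funext => N; rewrite /abs_mpseries /series/= big_mkord. Qed.

Lemma mpseries_cvg c z : cvgn (abs_mpseries c z) -> cvgn (mpseries c z).
Proof.
rewrite mpseriesE abs_mpseriesE => cv; apply: normed_cvg.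
apply: series_le_cvg cv => [k|k|k]; rewrite /= ?normr_ge0//.
  exact: abs_deg_part_ge0.
exact: norm_deg_part.
Qed.

Lemma norm_mpseries_lim c z : cvgn (abs_mpseries c z) ->
  `|limn (mpseries c z)| <= limn (abs_mpseries c z).
Proof.
move=> cv; have cp := mpseries_cvg cv.
rewrite -lim_norm//; apply: ler_lim => //; first exact: is_cvg_norm.
near=> N; apply: le_trans (ler_norm_sum _ _ _) _; apply: ler_sum => k _.
exact: norm_deg_part.
Unshelve. all: by end_near. Qed.

Section Division.
Variables (i : 'I_n) (c : {ffun 'I_n -> nat} -> R).

(** Exact already for partial sums: division by [z_i] lowers the degree by one, hence [N] against
    [N.+1]. *)
Lemma mpseries_div z N : mpseries c z N.+1 =
  mpseries c (set0_at i z) N.+1 + z 0 i * mpseries (div_coef i c) z N.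
Proof.
rewrite /mpseries mulr_sumr [in RHS]big_ord_recl [in LHS]big_ord_recl/=.
have cE k : deg_part c z k = deg_part c (set0_at i z) k +
    deg_part (mul_coef i (div_coef i c)) z k.
  rewrite -deg_part_const -deg_partD; apply: eq_deg_part => a; exact: coef_decomp.
rewrite cE deg_part_mul0 addr0 -addrA; congr +%R; rewrite -big_split/=.
by apply: eq_bigr => k _; rewrite deg_part_mul -cE.
Qed.

Lemma abs_mpseries_div z N : `|z 0 i| * abs_mpseries (div_coef i c) z N <=
  abs_mpseries c z N.+1.
Proof.
rewrite /abs_mpseries mulr_sumr [leRHS]big_ord_recl/= ler_wpDl ?abs_deg_part_ge0//.
apply: ler_sum => k _; rewrite !abs_deg_partE.
have -> : `|z 0 i| = map_mx Num.norm z 0 i by rewrite mxE.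
rewrite deg_part_mul -!abs_deg_partE /bump/= add1n.
apply: ler_sum => a _; rewrite norm_monom ler_wpM2r -?norm_monom//.
rewrite /mul_coef; case: ifPn => // ai.
by rewrite [in leRHS](coef_decomp i c) /const_coef /mul_coef ai add0r.
Qed.

Lemma abs_mpseries_div_cvg z : z 0 i != 0 ->
  cvgn (abs_mpseries c z) -> cvgn (abs_mpseries (div_coef i c) z).
Proof.
move=> zi cv; apply: (@abs_mpseries_cvgP _ _ (limn (abs_mpseries c z) / `|z 0 i|)) => N.
rewrite ler_pdivlMr ?normr_gt0// mulrC (le_trans (abs_mpseries_div _ _))//.
exact: abs_mpseries_le_lim.
Qed.

(** The dominating point [z'] is there for the case [z_i = 0], where convergence of [c] at [z] says
    nothing about the quotient series; at [z'], with [z'_i] nonzero, it does. *)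
Lemma lim_mpseries_div z z' : (forall j, `|z 0 j| <= `|z' 0 j|) -> z' 0 i != 0 ->
  cvgn (abs_mpseries c z') ->
  limn (mpseries c z) =
  limn (mpseries c (set0_at i z)) + z 0 i * limn (mpseries (div_coef i c) z).
Proof.
move=> zz' z'i cv.
have cz : cvgn (mpseries c z) by apply: mpseries_cvg; exact: abs_mpseries_cvg_le cv.
have c0 : cvgn (mpseries c (set0_at i z)).
  apply: mpseries_cvg; apply: abs_mpseries_cvg_le cv => j; rewrite mxE.
  by case: eqP => // _; rewrite normr0.
have cd : cvgn (mpseries (div_coef i c) z).
  apply: mpseries_cvg; apply: abs_mpseries_cvg_le zz' _.
  exact: abs_mpseries_div_cvg.
apply/cvg_lim => //; rewrite -(cvg_shiftS).
rewrite (_ : [sequence _]_N = (fun N => mpseries c (set0_at i z) N.+1 +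
   z 0 i * mpseries (div_coef i c) z N)); last first.
  by apply/funext => N; rewrite /= mpseries_div.
by apply: cvgD; [rewrite cvg_shiftS|exact: cvgMl_tmp].
Qed.

End Division.
End PowerSeries.

(** * Derivatives along lines, and boxes inside open sets *)

Section Lines.
Variable R : realType.

Lemma is_derive_cvg (V : normedModType R) (f : V -> R) a v l :
  (fun h => h^-1 *: ((f \o shift a) (h *: v) - f a)) @ 0^' --> l ->
  is_derive a v f l.
Proof.
move=> fl; split; first by apply/cvg_ex; exists l.
exact/cvg_lim.
Qed.

Lemma is_derive_line (V : normedModType R) (f : V -> R) a v l :
  is_derive a v f l <-> is_derive (0 : R) 1 (fun h => f (h *: v + a)) l.
Proof.
have e : (fun h => h^-1 *: ((f \o shift a) (h *: v) - f a)) =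
   (fun h : R => h^-1 *: (((fun h => f (h *: v + a)) \o shift 0) (h *: 1) -
     f (0 *: v + a))).
  by apply/funext => h /=; rewrite addr0 scale0r add0r [h *: 1]mulr1.
by split=> -[d1 d2]; split; move: d1 d2; rewrite /derivable /derive e.
Qed.

Lemma rV_ball n (x y : 'rV[R]_n) r : 0 < r ->
  (forall i, `|y 0 i - x 0 i| < r) <-> ball x r y.
Proof.
move=> r0; split=> [H|[_ H] i]; last by rewrite distrC; exact: H.
by split => // i j; rewrite ord1 /ball/= distrC.
Qed.

Lemma open_box n (D : set 'rV[R]_n) x : open D -> D x ->
  exists2 r : R, 0 < r & forall y : 'rV[R]_n, (forall i, `|y 0 i - x 0 i| < r) -> D y.
Proof.
rewrite openE => oD /oD; rewrite /interior => /nbhs_ballP[r /= r0 H].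
by exists r => // y /(rV_ball _ _ r0)/H.
Qed.

(** Supplies the dominating point for power series: [const_mx rho] bounds [z] coordinatewise, stays
    in the box of convergence and has no zero coordinate, even if [z = 0]. *)
Lemma row_le_radius n (z : 'rV[R]_n) (r : R) : 0 < r -> (forall j, `|z 0 j| < r) ->
  exists2 rho, 0 < rho < r & forall j, `|z 0 j| <= rho.
Proof.
move=> r0 zr; pose m := \big[Order.max/0]_j `|z 0 j|.
have mr : m < r by apply/bigmax_ltP; split.
have m0 : 0 <= m by exact: bigmax_ge_id.
exists ((m + r) / 2); first by lra.
move=> j; have : `|z 0 j| <= m by exact: (le_bigmax _ (fun j => `|z 0 j|)).
lra.
Qed.

End Lines.

(** * The Hadamard quotient of an analytic function *)

Section AnalyticDivision.
Variables (R : realType) (n : nat).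
Implicit Types (c : {ffun 'I_n -> nat} -> R) (z : 'rV[R]_n).

Definition expands_at (x0 : 'rV[R]_n) (r : R) c (phi : 'rV[R]_n -> R) :=
  forall x : 'rV[R]_n, (forall i, `|x 0 i - x0 0 i| < r) ->
    cvgn (abs_mpseries c (x - x0)) /\ mpseries c (x - x0) @ \oo --> phi x.

(** Dividing twice by the coordinate gives [phi (x + t e_i) = phi x + t (q z + t q2 (z + t e_i))].
    The second quotient is bounded by its absolute series at [z'], so the difference quotient is
    within a multiple of [|t|] of [q z]. *)
Lemma expands_at_derive (i : 'I_n) (x0 : 'rV[R]_n) r c phi (x : 'rV[R]_n) : 0 < r -> expands_at x0 r c phi ->
  (forall j, `|x 0 j - x0 0 j| < r) -> x 0 i = x0 0 i ->
  is_derive x (evec R i) phi (limn (mpseries (div_coef i c) (x - x0))).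
Proof.
move=> r0 ec xr xi; set z := x - x0.
have zi : z 0 i = 0 by rewrite !mxE xi subrr.
have zr j : `|z 0 j| < r by rewrite !mxE.
have [rho /andP[rho0 rhor] zm] := row_le_radius r0 zr.
pose z' : 'rV[R]_n := const_mx rho.
have z'E j : `|z' 0 j| = rho by rewrite mxE gtr0_norm.
have z'i : z' 0 i != 0 by rewrite mxE gt_eqF.
have cv : cvgn (abs_mpseries c z').
  have [] := ec (x0 + z'); last by rewrite addrAC subrr add0r.
  by move=> j; rewrite !mxE addrAC subrr add0r gtr0_norm.
have zt (t : R) : `|t| < rho -> forall j, `|(z + t *: evec R i) 0 j| <= `|z' 0 j|.
  move=> t1 j; rewrite z'E !mxE /=; have [->|ji] := eqVneq j i.
    by rewrite mulr1 xi subrr add0r ltW.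
  by rewrite mulr0 addr0; move: (zm j); rewrite !mxE.
have s0 (t : R) : set0_at i (z + t *: evec R i) = z.
  apply/rowP => j; rewrite mxE; have [->|ji] := eqVneq j i; first by rewrite zi.
  by rewrite !mxE/= (negPf ji) mulr0 addr0.
have zti (t : R) : (z + t *: evec R i) 0 i = t.
  by rewrite mxE zi add0r !mxE !eqxx mulr1.
pose d2 := div_coef i (div_coef i c).
have cvd : cvgn (abs_mpseries (div_coef i c) z') by exact: abs_mpseries_div_cvg.
have cvd2 : cvgn (abs_mpseries d2 z') by exact: abs_mpseries_div_cvg.
have phiE (t : R) : `|t| < rho -> phi (t *: evec R i + x) =
    phi x + t * (limn (mpseries (div_coef i c) z) +
                 t * limn (mpseries d2 (z + t *: evec R i))).
  move=> t1; have lx : phi x = limn (mpseries c z).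
    by apply/esym/cvg_lim => //; have [] := ec x xr.
  have -> : phi (t *: evec R i + x) = limn (mpseries c (z + t *: evec R i)).
    apply/esym/cvg_lim => //; have [] := ec (t *: evec R i + x).
      move=> j; have := zt _ t1 j; rewrite z'E !mxE => zj.
      by rewrite -addrA addrC; apply: le_lt_trans rhor.
    by rewrite -addrA addrC.
  rewrite (lim_mpseries_div (zt _ t1) z'i cv) s0 zti lx.
  by rewrite (lim_mpseries_div (zt _ t1) z'i cvd) s0 zti.
apply: is_derive_cvg; apply/subr_cvg0 => /=.
apply: (@cvg_to_0_linear _ _ (limn (abs_mpseries d2 z')) rho rho0) => t /andP[t0 t1].
rewrite phiE// addrAC subrr add0r [_ *: _]mulrA mulVf -?normr_gt0// mul1r.
rewrite addrAC subrr add0r normrM mulrC ler_wpM2r//.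
have cvt : cvgn (abs_mpseries d2 (z + t *: evec R i)) by exact: abs_mpseries_cvg_le (zt _ t1) cvd2.
apply: le_trans (norm_mpseries_lim cvt) _; apply: ler_lim => //.
near=> N; apply: ler_sum => k _; apply: abs_deg_part_le; exact: zt.
Unshelve. all: by end_near. Qed.

Lemma analytic_derivable (D : set 'rV[R]_n) phi x i :
  analytic_on D phi -> D x -> derivable phi x (evec R i).
Proof.
move=> aphi /aphi[r r0 [c ec]].
have xx j : `|x 0 j - x 0 j| < r by rewrite subrr normr0.
by have [] := @expands_at_derive i x r c phi x r0 ec xx erefl.
Qed.

(** Hadamard quotient [phi / y_i], continued by [d phi / d y_i] on [y_i = 0] *)
Definition had (i : 'I_n) (phi : 'rV[R]_n -> R) : 'rV[R]_n -> R :=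
  fun y => if y 0 i == 0 then pderiv i phi y else (y 0 i)^-1 * phi y.

Section Geometric.
Variables (i : 'I_n) (y0 : R) (y00 : y0 != 0) (c : {ffun 'I_n -> nat} -> R).

(** Solves [c = y0 * g + mul_coef i g] for [g] by recursion on the exponent of [z_i], for which [m]
    stands. *)
Fixpoint geo_coef_rec m (a : {ffun 'I_n -> nat}) : R :=
  (c a - (if m is m'.+1 then geo_coef_rec m' (mi_decr i a) else 0)) / y0.
(** coefficients of [f z / (y0 + z_i)] *)
Definition geo_coef (a : {ffun 'I_n -> nat}) := geo_coef_rec (a i) a.

Lemma geo_coefE a : c a = y0 * geo_coef a + mul_coef i geo_coef a.
Proof.
rewrite /geo_coef /mul_coef; case E : (a i) => [|m] /=.
  by rewrite subr0 addr0 mulrC divfK.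
by rewrite ffunE E eqxx subn1/= [y0 * _]mulrC divfK// subrK.
Qed.

(** Truncation leaves one boundary term, the homogeneous part of degree [N]. It tends to 0 once the
    series of [geo_coef] is known to converge. *)
Lemma mpseries_geo z N : (y0 + z 0 i) * mpseries geo_coef z N.+1 =
  mpseries c z N.+1 + z 0 i * deg_part geo_coef z N.
Proof.
have cE k : deg_part c z k = y0 * deg_part geo_coef z k +
    deg_part (mul_coef i geo_coef) z k.
  by rewrite -deg_partZ -deg_partD; apply: eq_deg_part => a; exact: geo_coefE.
have -> : mpseries c z N.+1 = y0 * mpseries geo_coef z N.+1 + z 0 i * mpseries geo_coef z N.
  rewrite /mpseries (eq_bigr _ (fun (k : 'I_N.+1) _ => cE k)) big_split/= -mulr_sumr.
  congr +%R; rewrite big_ord_recl/= deg_part_mul0 add0r mulr_sumr.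
  by apply: eq_bigr => k _; rewrite deg_part_mul.
rewrite mulrDl -addrA -mulrDr; congr (_ + _ * _).
by rewrite /mpseries big_ord_recr.
Qed.

Lemma abs_mpseries_geo z N : `|y0| * abs_mpseries geo_coef z N.+1 <=
  abs_mpseries c z N.+1 + `|z 0 i| * abs_mpseries geo_coef z N.
Proof.
have zE : `|z 0 i| = map_mx Num.norm z 0 i by rewrite mxE.
have cE k : `|y0| * abs_deg_part geo_coef z k <= abs_deg_part c z k +
    deg_part (mul_coef i (fun a => `|geo_coef a|)) (map_mx Num.norm z) k.
  rewrite !abs_deg_partE -deg_partZ -deg_partD; apply: ler_sum => a _.
  rewrite ler_wpM2r -?norm_monom//.
  have -> : `|y0| * `|geo_coef (mi a)| = `|c (mi a) - mul_coef i geo_coef (mi a)|.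
    by rewrite [c _]geo_coefE addrK normrM.
  rewrite (le_trans (ler_normB _ _))// lerD2l /mul_coef.
  by case: ifP; rewrite ?normr0.
rewrite /abs_mpseries mulr_sumr (le_trans (ler_sum _ (fun (k : 'I_N.+1) _ => cE k)))//.
rewrite big_split/= lerD2l big_ord_recl/= deg_part_mul0 add0r mulr_sumr.
by apply: ler_sum => k _; rewrite -deg_part_mul -zE abs_deg_partE.
Qed.

(** The preceding inequality bounds the partial sums by themselves: replacing the sum up to [N] on
    its right by the larger one up to [N.+1] leaves the factor [|y0| - |z_i| > 0]. *)
Lemma abs_mpseries_geo_cvg z : `|z 0 i| < `|y0| -> cvgn (abs_mpseries c z) ->
  cvgn (abs_mpseries geo_coef z).
Proof.
move=> zy cv.
apply: (@abs_mpseries_cvgP _ _ _ _ (limn (abs_mpseries c z) / (`|y0| - `|z 0 i|))) => N.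
have le1 := nondecreasing_abs_mpseries geo_coef z (leqnSn N).
rewrite (le_trans le1)// ler_pdivlMr ?subr_gt0// mulrBr.
rewrite lerBlDr mulrC (le_trans (abs_mpseries_geo _ _))// lerD//.
  exact: abs_mpseries_le_lim.
by rewrite mulrC ler_wpM2r.
Qed.

Lemma mpseries_geo_cvg z l : `|z 0 i| < `|y0| -> cvgn (abs_mpseries c z) ->
  mpseries c z @ \oo --> l -> mpseries geo_coef z @ \oo --> (y0 + z 0 i)^-1 * l.
Proof.
move=> zy cv cl; have yz0 : y0 + z 0 i != 0.
  apply: contraTneq zy => /eqP; rewrite addrC addr_eq0 => /eqP ->.
  by rewrite normrN ltxx.
have cg := mpseries_cvg (abs_mpseries_geo_cvg zy cv).
have d0 : deg_part geo_coef z @ \oo --> 0.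
  by apply: cvg_series_cvg_0; rewrite -mpseriesE.
rewrite -(cvg_shiftS).
rewrite (_ : [sequence _]_N = (fun N => (y0 + z 0 i)^-1 *
  (mpseries c z N.+1 + z 0 i * deg_part geo_coef z N))); last first.
  by apply/funext => N; rewrite -mpseries_geo mulKf.
apply: cvgMl_tmp; rewrite -[X in _ --> X]addr0 -[X in _ --> _ + X](mulr0 (z 0 i)).
by apply: cvgD; [rewrite cvg_shiftS|exact: cvgMl_tmp].
Qed.

End Geometric.

Lemma analytic_had (D : set 'rV[R]_n) phi i : open D -> analytic_on D phi ->
  (forall y, D y -> y 0 i = 0 -> phi y = 0) -> analytic_on D (had i phi).
Proof.
move=> oD aphi phi0 x0 Dx0; have [r1 r10 [c ec]] := aphi _ Dx0.
have [r2 r20 rD] := open_box oD Dx0.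
have [x0i|x0i] := eqVneq (x0 0 i) 0; last first.
  (* The bound [|x0_i|] keeps [x_i] away from 0, so that [had] is a true quotient on the whole box,
     and it is also what convergence of [geo_coef] requires. *)
  exists (Num.min r1 `|x0 0 i|); first by rewrite lt_min r10 normr_gt0.
  exists (geo_coef i (x0 0 i) c) => x xr.
  have [x1 x2] : (forall j, `|x 0 j - x0 0 j| < r1) /\ `|x 0 i - x0 0 i| < `|x0 0 i|.
    by split=> [j|]; have := xr; [move/(_ j)|move/(_ i)]; rewrite lt_min => /andP[].
  have [ca cl] := ec _ x1; split.
    by apply: (abs_mpseries_geo_cvg x0i) => //; rewrite !mxE.
  have xi : x 0 i = x0 0 i + (x - x0) 0 i by rewrite !mxE addrCA subrr addr0.
  have xi0 : x 0 i != 0.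
    by apply: contraTneq x2 => ->; rewrite sub0r normrN ltxx.
  rewrite /had (negPf xi0) xi; apply: mpseries_geo_cvg => //.
  by rewrite !mxE.
pose r := Num.min r1 r2; have r0 : 0 < r by rewrite lt_min r10.
have er : expands_at x0 r c phi.
  by move=> x xr; apply: ec => j; apply: lt_le_trans (xr j) _; rewrite ge_min lexx.
exists r => //; exists (div_coef i c) => x xr.
have Dx : D x by apply: rD => j; apply: lt_le_trans (xr j) _; rewrite ge_min lexx orbT.
pose z := x - x0.
have zr j : `|z 0 j| < r by rewrite !mxE.
have [rho /andP[rho0 rhor] zm] := row_le_radius r0 zr.
pose z' : 'rV[R]_n := const_mx rho.
have z'E j : `|z' 0 j| = rho by rewrite mxE gtr0_norm.
have z'i : z' 0 i != 0 by rewrite mxE gt_eqF.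
have cv : cvgn (abs_mpseries c z').
  have [] := er (x0 + z'); last by rewrite addrAC subrr add0r.
  by move=> j; rewrite !mxE addrAC subrr add0r gtr0_norm.
have zz' j : `|z 0 j| <= `|z' 0 j| by rewrite z'E.
have ca : cvgn (abs_mpseries (div_coef i c) z).
  by apply: abs_mpseries_cvg_le zz' _; exact: abs_mpseries_div_cvg.
split => //.
suff -> : had i phi x = limn (mpseries (div_coef i c) z) by exact: mpseries_cvg.
rewrite /had; case: eqP => [xi|/eqP xi].
  have [_ d2] := @expands_at_derive i x0 r c phi x r0 er xr (etrans xi (esym x0i)).
  by rewrite /pderiv d2.
have -> : phi x = limn (mpseries c z) by apply/esym/cvg_lim => //; have [] := er _ xr.
rewrite (lim_mpseries_div zz' z'i cv).
(* This limit is the value of [phi] at the projection of [x] on [y_i = 0]; the radius [r2] keeps the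
   projection in [D], where [phi] vanishes on that hyperplane. *)
have -> : limn (mpseries c (set0_at i z)) = 0.
  pose xx := set0_at i z + x0.
  have xxr j : `|xx 0 j - x0 0 j| < r.
    by rewrite !mxE addrK; case: ifP => _; rewrite ?normr0// -[x in _ - x]opprK.
  rewrite -[RHS](phi0 xx).
  - by apply/cvg_lim => //; have [_] := er _ xxr; rewrite /xx addrK.
  - by apply: rD => j; apply: lt_le_trans (xxr j) _; rewrite ge_min lexx orbT.
  - by rewrite !mxE eqxx x0i addr0.
by rewrite add0r !mxE x0i subr0 mulKf.
Qed.

Lemma analytic_cst0 (D : set 'rV[R]_n) : analytic_on D (fun=> 0).
Proof.
move=> x0 _; exists 1 => //; exists (fun=> 0) => x _.
have d0 k : deg_part (fun=> 0) (x - x0) k = 0.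
  by rewrite /deg_part big1// => a _; rewrite mul0r.
have a0 k : abs_deg_part (fun=> 0) (x - x0) k = 0.
  by rewrite /abs_deg_part big1// => a _; rewrite normr0 mul0r.
split.
  under eq_fun do under eq_bigr do rewrite a0.
  by under eq_fun do rewrite big1_eq; exact: is_cvg_cst.
under eq_fun do under eq_bigr do rewrite d0.
by under eq_fun do rewrite big1_eq; exact: cvg_cst.
Qed.

End AnalyticDivision.

(** * Smooth functions and division by a coordinate *)

Section SmoothLocal.
Variables (R : realType) (n : nat).
Implicit Types (x : 'rV[R]_n) (D U : set 'rV[R]_n) (phi psi : 'rV[R]_n -> R).

Lemma near_open_eq U phi psi x : open U -> U x ->
  (forall y, U y -> phi y = psi y) -> \forall y \near x, phi y = psi y.
Proof.
rewrite openE => oU /oU; rewrite /interior => Ux e.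
by apply: filterS Ux => y; exact: e.
Qed.

Lemma near_eq_continuous phi psi x : (\forall y \near x, phi y = psi y) ->
  {for x, continuous phi} -> {for x, continuous psi}.
Proof.
move=> e; rewrite /prop_for /continuous_at -(nbhs_singleton e).
by move=> c; apply: cvg_trans (near_eq_cvg e) c.
Qed.

Lemma eq_pderiv_open U phi psi i : open U -> (forall y, U y -> phi y = psi y) ->
  forall y, U y -> pderiv i phi y = pderiv i psi y.
Proof.
move=> oU e y Uy; rewrite /pderiv; apply: near_eq_derive.
exact: near_open_eq oU Uy e.
Qed.

Lemma iter_pderiv_eq U phi psi l : open U -> (forall y, U y -> phi y = psi y) ->
  forall y, U y -> iter_pderiv l phi y = iter_pderiv l psi y.
Proof. by move=> oU e; elim: l => //= i l IH; exact: eq_pderiv_open. Qed.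

Lemma smooth_on_local D phi :
  (forall x, D x -> exists U psi,
     [/\ open U, U x, smooth_on U psi & forall y, U y -> phi y = psi y]) ->
  smooth_on D phi.
Proof.
move=> H l x /H[U [psi [oU Ux spsi e]]]; have [c d] := spsi l x Ux.
have ne : \forall y \near x, iter_pderiv l psi y = iter_pderiv l phi y.
  by apply: (near_open_eq oU Ux) => y Uy; apply/esym; exact: (iter_pderiv_eq _ oU e Uy).
split; first exact: near_eq_continuous ne c.
by move=> i; exact: near_eq_derivable ne (d i).
Qed.

Lemma smooth_on_sub D U phi : D `<=` U -> smooth_on U phi -> smooth_on D phi.
Proof. by move=> DU s l x /DU; exact: s. Qed.

(** Smoothness without computing iterated derivatives: each of them coincides on [D] with a member
    of the class. Agreement on an open set is enough to transfer continuity and derivability. *)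
Lemma smooth_on_class D (P : ('rV[R]_n -> R) -> Prop) : open D ->
  (forall phi x, P phi -> D x ->
     {for x, continuous phi} /\ forall i, derivable phi x (evec R i)) ->
  (forall phi i, P phi ->
     exists2 psi, P psi & forall x, D x -> pderiv i phi x = psi x) ->
  forall phi, P phi -> smooth_on D phi.
Proof.
move=> oD PC PD phi Pphi l.
suff [psi Ppsi e] : exists2 psi, P psi & forall x, D x -> iter_pderiv l phi x = psi x.
  move=> x Dx; have [c d] := PC _ _ Ppsi Dx.
  have ne : \forall y \near x, psi y = iter_pderiv l phi y.
    by apply: (near_open_eq oD Dx) => y Uy; rewrite e.
  by split=> [|i]; [exact: near_eq_continuous ne c|exact: near_eq_derivable ne (d i)].
elim: l => [|i l [psi Ppsi e]] /=; first by exists phi.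
have [psi' Ppsi' e'] := PD _ i Ppsi; exists psi' => // x Dx.
by rewrite -e'//; exact: (eq_pderiv_open i oD e Dx).
Qed.

Lemma smooth_on_pderiv D phi i : smooth_on D phi -> smooth_on D (pderiv i phi).
Proof.
move=> s l; have := s (rcons l i).
by rewrite /iter_pderiv foldr_rcons.
Qed.

Lemma smooth_on_cst D (k : R) : smooth_on D (fun=> k).
Proof.
move=> l x _.
have [k' ->] : exists k', iter_pderiv l (fun=> k) = (fun=> k').
  elim: l => [|i l [k' IH]] /=; first by exists k.
  by exists 0; rewrite IH; apply/funext => y; exact: derive_cst.
split; first exact: cst_continuous.
by move=> i; exact: derivable_cst.
Qed.

Section Quotient.
Variables (i : 'I_n) (D : set 'rV[R]_n).
Hypothesis oD : open D.
Hypothesis D0 : forall y, D y -> y 0 i != 0.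

(** Closed under partial derivatives: the derivative of [1 / y_i] is 0 or minus its square, and
    Leibniz does the rest. *)
Inductive quot_class : ('rV[R]_n -> R) -> Prop :=
| quot_smooth phi of smooth_on D phi : quot_class phi
| quot_inv : quot_class (fun y => (y 0 i)^-1)
| quot_mul phi psi of quot_class phi & quot_class psi :
    quot_class (phi * psi)
| quot_add phi psi of quot_class phi & quot_class psi :
    quot_class (phi + psi).

Lemma is_derive_coord (y : 'rV[R]_n) j :
  is_derive y (evec R j) (fun y => y 0 i) (i == j)%:R.
Proof.
apply: is_derive_cvg; apply/cvgrPdist_lt => e e0; near=> h.
have h0 : h != 0 by near: h; exact: nbhs_dnbhs_neq.
by rewrite /= !mxE eqxx/= addrK [_ *: _]mulrA mulVf// mul1r subrr normr0.
Unshelve. all: by end_near. Qed.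

Lemma quot_class_reg phi x : quot_class phi -> D x ->
  {for x, continuous phi} /\ forall j, derivable phi x (evec R j).
Proof.
move=> q Dx; elim: q => [{}phi s||{}phi psi _ [c1 d1] _ [c2 d2]|{}phi psi _ [c1 d1] _ [c2 d2]].
- exact: s [::] x Dx.
- split=> [|j].
    by apply: continuousV; [exact: D0|exact: coord_continuous].
  apply: (@derivableV _ _ (fun y : 'rV[R]_n => y 0 i)); first exact: D0.
  by case: (is_derive_coord x j).
- by split=> [|j]; [exact: continuousM|exact: derivableM].
- by split=> [|j]; [exact: continuousD|exact: derivableD].
Qed.

Lemma quot_class_deriv phi j : quot_class phi ->
  exists2 psi, quot_class psi & forall x, D x -> pderiv j phi x = psi x.
Proof.
elim=> [{}phi s||{}phi psi q1 [dphi p1 e1] q2 [dpsi p2 e2]|{}phi psi q1 [dphi p1 e1] q2 [dpsi p2 e2]].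
- by exists (pderiv j phi) => //; apply: quot_smooth; exact: smooth_on_pderiv.
- exists ((fun=> - (i == j)%:R) * ((fun y => (y 0 i)^-1) * (fun y => (y 0 i)^-1))).
    apply: quot_mul; first by apply: quot_smooth; exact: smooth_on_cst.
    by apply: quot_mul; exact: quot_inv.
  move=> x Dx; have [d e] := is_derive_coord x j.
  rewrite /pderiv (@deriveV _ _ (fun y : 'rV[R]_n => y 0 i)) ?e ?D0//.
  rewrite !fctE [_ *: _]mulrC mulrN mulNr; congr (- (_ * _)).
  by rewrite expr2 invfM.
- exists (phi * dpsi + psi * dphi).
    by apply: quot_add; apply: quot_mul.
  move=> x Dx; have [_ d1] := quot_class_reg q1 Dx; have [_ d2] := quot_class_reg q2 Dx.
  by rewrite /pderiv deriveM// !fctE -e1// -e2.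
- exists (dphi + dpsi); first exact: quot_add.
  move=> x Dx; have [_ d1] := quot_class_reg q1 Dx; have [_ d2] := quot_class_reg q2 Dx.
  by rewrite /pderiv deriveD// !fctE -e1// -e2.
Qed.

Lemma smooth_on_quot phi : smooth_on D phi -> smooth_on D (fun y => (y 0 i)^-1 * phi y).
Proof.
move=> s; apply: (smooth_on_class oD quot_class_reg quot_class_deriv).
by apply: (@quot_mul (fun y => (y 0 i)^-1) phi); [exact: quot_inv|exact: quot_smooth].
Qed.

End Quotient.
End SmoothLocal.

Section Affine.
Variable R : realType.

Lemma is_derive_affine (V : normedModType R) (f : V -> R) a v d (t0 c : R) :
  is_derive a v f d ->
  is_derive t0 1 (fun t : R => f (((t - t0) * c) *: v + a)) (c * d).
Proof.
move=> /is_derive_line df; rewrite mulrC.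
apply: (@is_derive1_comp _ (fun h => f (h *: v + a)) (fun t : R => (t - t0) * c)).
  by rewrite subrr mul0r.
have -> : (fun t : R => (t - t0) * c) = c *: (id - cst t0).
  by apply/funext => t; rewrite mulrC.
apply: is_derive_eq.
by rewrite subr0 [_ *: _]mulr1.
Qed.

End Affine.

(** * Segments to the hyperplane [y_i = 0] and averages over them *)

Section Scaling.
Variables (R : realType) (n : nat) (i : 'I_n).
Implicit Types (s : R) (y : 'rV[R]_n).

(** Runs from the projection of [y] on [y_i = 0], at [s = 0], to [y], at [s = 1]. Written as a
    translate along [evec R i], so that joint continuity and changes of [s] come from vector
    operations. *)
Definition scale_at s y : 'rV[R]_n := y - ((1 - s) * y 0 i) *: evec R i.

Lemma scale_atE s y j : scale_at s y 0 j = if j == i then s * y 0 i else y 0 j.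
Proof.
rewrite !mxE eqxx /=; case: eqP => [->|_]; last by rewrite mulr0 subr0.
by rewrite mulr1 mulrBl mul1r opprB addrC subrK.
Qed.

Lemma scale_at1 y : scale_at 1 y = y.
Proof. by rewrite /scale_at subrr mul0r scale0r subr0. Qed.

Lemma scale_at_id s y : y 0 i = 0 -> scale_at s y = y.
Proof. by move=> yi; rewrite /scale_at yi mulr0 scale0r subr0. Qed.

Lemma scale_at_line s y j h : scale_at s (h *: evec R j + y) =
  (h * (if j == i then s else 1)) *: evec R j + scale_at s y.
Proof.
apply/rowP => l; rewrite [RHS]mxE !scale_atE.
have [->|ji] := eqVneq j i; rewrite !mxE !eqxx/=.
  by case: eqP => [_|_]; rewrite ?mulr1 ?mulr0 ?add0r// mulrDr [s * h]mulrC.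
have ij : (i == j) = false by rewrite eq_sym (negPf ji).
by case: eqP => [->|_]; rewrite ?ij ?mulr0 ?add0r ?mulr1.
Qed.

Lemma scale_at_shift s s0 y :
  scale_at s y = ((s - s0) * y 0 i) *: evec R i + scale_at s0 y.
Proof.
rewrite /scale_at addrCA -scaleNr -[in RHS]scaleNr -scalerDl; congr (_ + _ *: _).
by ring.
Qed.

Lemma scale_at_continuous (s0 : R) (y0 : 'rV[R]_n) :
  (fun p : R * 'rV[R]_n => scale_at p.1 p.2) @ (s0, y0) --> scale_at s0 y0.
Proof.
rewrite /scale_at; apply: (@cvgB R 'rV[R]_n _ _ _ (fun p : R * 'rV[R]_n => p.2)); first exact: cvg_snd.
apply: cvgZr_tmp; apply: cvgM.
  by apply: cvgB; [exact: cvg_cst|exact: cvg_fst].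
apply: (@cvg_comp _ _ _ snd (fun M : 'rV[R]_n => M 0 i) _ (nbhs y0)); first exact: cvg_snd.
exact: coord_continuous.
Qed.

Variables (x0 : 'rV[R]_n) (r : R).
Hypotheses (r0 : 0 < r) (x0i : x0 0 i = 0).
Let U := ball x0 r.

(** Since the centre lies on [y_i = 0], the ball contains the whole segment of each of its points.
    This is why averages are used only near that hyperplane. *)
Lemma scale_at_ball s y : 0 <= s <= 1 -> U y -> U (scale_at s y).
Proof.
move=> /andP[s0 s1] /(rV_ball _ _ r0) Uy; apply/(rV_ball _ _ r0) => j.
rewrite scale_atE; have := Uy j; case: eqP => // ->.
rewrite x0i !subr0 normrM (ger0_norm s0); apply: le_lt_trans.
by rewrite ler_piMl.
Qed.

Section Tube.
Variable phi : 'rV[R]_n -> R.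
Hypothesis cphi : forall y, U y -> {for y, continuous phi}.

(** Compactness of [[0, 1]] makes the neighbourhood of [y] uniform in [s]; both continuity of the
    averages and domination of their derivatives rest on it. *)
Lemma scale_at_tube y (e : R) : U y -> 0 < e ->
  \forall y' \near y, forall s, 0 <= s <= 1 ->
    `|phi (scale_at s y') - phi (scale_at s y)| < e.
Proof.
move=> Uy e0.
have /compact_near_coveringP := @segment_compact R 0 1.
move=> /(_ _ (nbhs y) (fun y' s => `|phi (scale_at s y') - phi (scale_at s y)| < e) _).
have H : forall s, `[0, 1] s ->
    \forall s' \near s & y' \near y, `|phi (scale_at s' y') - phi (scale_at s' y)| < e.
  move=> s /=; rewrite in_itv/= => s01.
  have cs := cphi (scale_at_ball s01 Uy).
  have e20 : 0 < e / 2 by rewrite divr_gt0.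
  have : \forall z \near scale_at s y, `|phi (scale_at s y) - phi z| < e / 2.
    by move/cvgrPdist_lt : cs; exact.
  move/(@scale_at_continuous s y).
  rewrite /= => -[[A B] /= [As By] AB].
  exists (A, B) => //= -[s' y'] /= [As' By'].
  have := AB (s', y') (conj As' By'); have := AB (s', y) (conj As' (nbhs_singleton By)).
  rewrite /= => h1 h2.
  rewrite -(subrK (phi (scale_at s y)) (phi (scale_at s' y'))) -addrA.
  rewrite (le_lt_trans (ler_normD _ _))// [e]splitr ltrD//.
  by rewrite distrC.
move=> /(_ H); apply: filterS => y' Hy s s01; apply: Hy => /=.
by rewrite in_itv.
Qed.

Lemma scale_at_continuous_s y s : U y -> 0 <= s <= 1 ->
  {for s, continuous (fun s => phi (scale_at s y))}.
Proof.
move=> Uy s01; apply: (@continuous_comp _ _ _ (fun s => scale_at s y) phi).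
  apply: (@cvg_comp _ _ _ (fun s : R => (s, y))
    (fun p : R * 'rV[R]_n => scale_at p.1 p.2) _ (nbhs (s, y))).
    by apply: (@cvg_pair _ _ _ _ (nbhs s) (nbhs y)); [exact: cvg_id|exact: cvg_cst].
  exact: scale_at_continuous.
exact: cphi (scale_at_ball s01 Uy).
Qed.

(** The weight [s ^+ k] closes the family under differentiation: a derivative in direction [i]
    brings out one factor [s] by the chain rule, the other directions bring none. *)
Definition avg_at k y : R :=
  \int[lebesgue_measure]_(s in `[0, 1]) (s ^+ k * phi (scale_at s y)).

Lemma avg_integrand_continuous k y s : U y -> 0 <= s <= 1 ->
  {for s, continuous (fun s => s ^+ k * phi (scale_at s y))}.
Proof.
move=> Uy s01.
apply: (@continuousM _ _ (fun s => s ^+ k) (fun s => phi (scale_at s y))).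
  exact: exprn_continuous.
exact: scale_at_continuous_s.
Qed.

Lemma avg_within k y : U y ->
  {within `[(0 : R), 1], continuous (fun s => s ^+ k * phi (scale_at s y))}.
Proof.
move=> Uy; apply: continuous_in_subspaceT => s; rewrite inE/= in_itv/= => s01.
exact: avg_integrand_continuous.
Qed.

Lemma avg_integrable k y : U y ->
  lebesgue_measure.-integrable `[(0 : R), 1]
    (EFin \o (fun s => s ^+ k * phi (scale_at s y))).
Proof.
move=> Uy; apply: continuous_compact_integrable; first exact: segment_compact.
exact: avg_within.
Qed.

End Tube.
End Scaling.

Section Averages.
Variables (R : realType) (n : nat) (i : 'I_n).
Variables (x0 : 'rV[R]_n) (r : R).
Hypotheses (r0 : 0 < r) (x0i : x0 0 i = 0).
Let U := ball x0 r.
Implicit Types (s t : R) (y : 'rV[R]_n) (phi : 'rV[R]_n -> R).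

Let fine01 : fine ((@lebesgue_measure R) `[(0 : R), 1]) = 1.
Proof. by rewrite lebesgue_measure_itv/= lte01 oppr0 addr0. Qed.

Let mu_cst (e : R) :
  (@lebesgue_measure R).-integrable `[(0 : R), 1] (EFin \o (fun=> e)).
Proof.
apply: continuous_compact_integrable; first exact: segment_compact.
by apply: continuous_subspaceT => s; exact: cst_continuous.
Qed.

Lemma avg_continuous phi k y : (forall y, U y -> {for y, continuous phi}) -> U y ->
  {for y, continuous (avg_at i phi k)}.
Proof.
move=> cphi Uy; apply/(@cvgrPdist_le _ _ _ (nbhs y)) => e e0; near=> y'.
have Uy' : U y' by near: y'; apply: open_nbhs_nbhs; split => //; exact: ball_open.
have i1 := avg_integrable r0 x0i cphi k Uy; have i2 := avg_integrable r0 x0i cphi k Uy'.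
have mI : measurable (`[(0 : R), 1]%classic : set (measurableTypeR R)) by exact: measurable_itv.
rewrite /avg_at -(RintegralB mI i1 i2).
set d := (fun s => _ - _).
have cd s : 0 <= s <= 1 -> {for s, continuous d}.
  by move=> s01; apply: (@continuousB R R^o); exact: (avg_integrand_continuous r0 x0i cphi).
have id : (@lebesgue_measure R).-integrable `[(0 : R), 1] (EFin \o d).
  apply: continuous_compact_integrable; first exact: segment_compact.
  by apply: continuous_in_subspaceT => s; rewrite inE/= in_itv/=; exact: cd.
apply: (le_trans (le_normr_Rintegral mI id)).
have -> : e = \int[lebesgue_measure]_(s in `[(0 : R), 1]) e.
  by rewrite Rintegral_cst// fine01 mulr1.
apply: le_Rintegral => //.
  apply: continuous_compact_integrable; first exact: segment_compact.
  apply: continuous_in_subspaceT => s; rewrite inE/= in_itv/= => s01.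
  apply: (@continuous_comp R R R d Num.norm); first exact: cd.
  exact: norm_continuous.
move=> s; rewrite /= in_itv/= => /andP[s0 s1]; rewrite /d -mulrBr normrM.
rewrite -[e]mul1r ler_pM//; first by rewrite ger0_norm ?exprn_ge0// exprn_ile1.
rewrite distrC; apply: ltW; have s01 : 0 <= s <= 1 by rewrite s0.
move: s {cd d id s0 s1} s01; near: y'.
exact: (scale_at_tube r0 x0i cphi Uy e0).
Unshelve. all: by end_near. Qed.

Lemma avg_derive phi k j y : (forall y, U y -> {for y, continuous phi}) ->
  (forall y, U y -> derivable phi y (evec R j)) ->
  (forall y, U y -> {for y, continuous (pderiv j phi)}) -> U y ->
  is_derive y (evec R j) (avg_at i phi k) (avg_at i (pderiv j phi) (k + (j == i)) y).
Proof.
move=> cphi dphi cdphi Uy.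
have nU : \forall y' \near y, U y' /\ forall s, 0 <= s <= 1 ->
    `|pderiv j phi (scale_at i s y') - pderiv j phi (scale_at i s y)| < 1.
  apply: filterI; first by apply: open_nbhs_nbhs; split => //; exact: ball_open.
  exact: (scale_at_tube r0 x0i cdphi Uy ltr01).
have [dl /= dl0 Hdl] : exists2 dl : R, 0 < dl & forall t, `|t| < dl ->
    U (t *: evec R j + y) /\ forall s, 0 <= s <= 1 ->
    `|pderiv j phi (scale_at i s (t *: evec R j + y)) -
      pderiv j phi (scale_at i s y)| < 1.
  have : (fun t : R => t *: evec R j + y) @ (0 : R) --> (0 : R) *: evec R j + y.
    by apply: cvgD; [apply: cvgZr_tmp; exact: cvg_id|exact: cvg_cst].
  rewrite scale0r add0r => /(_ _ nU) /nbhs_ballP[dl /= dl0 H]; exists dl => // t tdl.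
  by apply: H; rewrite /ball/= sub0r normrN.
pose c s := if j == i then s else 1.
pose f (t : R) s := s ^+ k * phi (scale_at i s (t *: evec R j + y)).
have tdl t : `]- dl, dl[%classic t -> `|t| < dl by rewrite /= in_itv/= ltr_norml.
have df t s : `|t| < dl -> 0 <= s <= 1 ->
    is_derive t (1 : R) (f ^~ s)
      (s ^+ (k + (j == i)) * pderiv j phi (scale_at i s (t *: evec R j + y))).
  move=> /Hdl[Ut _] s01; have Us := scale_at_ball r0 x0i s01 Ut.
  have /is_derive_affine := derivableP (dphi _ Us).
  move=> /(_ t (c s)) d.
  have -> : f ^~ s = s ^+ k *: (fun t' => phi (((t' - t) * c s) *: evec R j +
      scale_at i s (t *: evec R j + y))).
    apply/funext => t'; rewrite /f -[X in scale_at i s (X *: _ + _)](subrK t t').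
    by rewrite scalerDl -addrA [in LHS]scale_at_line.
  apply: is_derive_eq; rewrite exprD /c [_ *: _]mulrA; congr (_ * _ * _).
  by case: eqP.
have mI : measurable (`[(0 : R), 1]%classic : set (measurableTypeR R)) by exact: measurable_itv.
have zI : `]- dl, dl[%classic (0 : R) by rewrite /= in_itv/= oppr_lt0 dl0.
(* Dominating function for differentiation under the integral: the derivative at the base point,
   plus the margin 1 granted by the tube lemma. *)
pose G s := `|pderiv j phi (scale_at i s y)| + 1.
have cG : {within `[(0 : R), 1], continuous G}.
  apply: continuous_in_subspaceT => s; rewrite inE/= in_itv/= => s01.
  apply: (@continuousD _ R^o _ (fun s => `|pderiv j phi (scale_at i s y)|)); last exact: cst_continuous.
  apply: (@continuous_comp _ R R (fun s => pderiv j phi (scale_at i s y)) Num.norm).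
    exact: (scale_at_continuous_s r0 x0i cdphi).
  exact: norm_continuous.
have := @cvg_differentiation_under_integral R _ _ lebesgue_measure f `[(0 : R), 1] mI
  0 (- dl) dl zI _ _ G.
have i1 : forall t, `]- dl, dl[%classic t ->
    (@lebesgue_measure R).-integrable `[(0 : R), 1] (EFin \o f t).
  by move=> t /tdl/Hdl[Ut _]; exact: (avg_integrable r0 x0i cphi k Ut).
have i2 t s : `]- dl, dl[%classic t -> `[(0 : R), 1]%classic s -> derivable (f^~ s) t 1.
  by move=> /tdl tt; rewrite /= in_itv/= => /(df _ _ tt)[].
move=> /(_ i1 i2); have i3 s : 0 <= G s by rewrite addr_ge0.
move=> /(_ i3); have i4 : (@lebesgue_measure R).-integrable `[(0 : R), 1] (EFin \o G).
  by apply: continuous_compact_integrable => //; exact: segment_compact.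
move=> /(_ i4) H; apply: is_derive_cvg.
have -> : (fun h => h^-1 *: ((avg_at i phi k \o shift y) (h *: evec R j) -
    avg_at i phi k y)) = (fun h : R => h^-1 *:
    (\int[lebesgue_measure]_(s in `[(0 : R), 1]) f (h + 0) s -
     \int[lebesgue_measure]_(s in `[(0 : R), 1]) f 0 s)).
  apply/funext => h; rewrite /= addr0 /avg_at /f; congr (_ *: (_ - _)).
  by apply: eq_Rintegral => s _; rewrite scale0r add0r.
have -> : avg_at i (pderiv j phi) (k + (j == i)) y =
    \int[lebesgue_measure]_(s in `[(0 : R), 1]) partial1of2 f 0 s.
  apply: eq_Rintegral => s; rewrite inE/= in_itv/= => s01.
  have z0 : `|0 : R| < dl by rewrite normr0.
  rewrite partial1of2E; have [_ ->] := df _ _ z0 s01.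
  by rewrite scale0r add0r.
apply: H => t s /tdl tt; rewrite /= in_itv/= => s01.
rewrite partial1of2E; have [_ ->] := df _ _ tt s01.
have [_ /(_ s s01) b1] := Hdl _ tt.
rewrite normrM /G -[leRHS]mul1r ler_pM//.
  by move/andP: s01 => [s0 s1]; rewrite ger0_norm ?exprn_ge0// exprn_ile1.
rewrite -lerBlDl; apply: le_trans (ltW b1); exact: lerB_dist.
Qed.

Lemma avg_smooth phi k : smooth_on U phi -> smooth_on U (avg_at i phi k).
Proof.
move=> sphi; pose P psi := exists k phi, smooth_on U phi /\ psi = avg_at i phi k.
apply: (@smooth_on_class _ _ U P); last by exists k, phi.
- exact: ball_open.
- move=> _ y [k' [phi' [s' ->]]] Uy.
  have c' y' (Uy' : U y') := (s' [::] y' Uy').1.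
  split=> [|j]; first exact: avg_continuous.
  have d' y' (Uy' : U y') := (s' [::] y' Uy').2 j.
  have cd' y' (Uy' : U y') := (s' [:: j] y' Uy').1.
  by have [] := avg_derive k' c' d' cd' Uy.
- move=> _ j [k' [phi' [s' ->]]].
  exists (avg_at i (pderiv j phi') (k' + (j == i))).
    by exists (k' + (j == i))%N, (pderiv j phi'); split => //; exact: smooth_on_pderiv.
  move=> y Uy.
  have c' y' (Uy' : U y') := (s' [::] y' Uy').1.
  have d' y' (Uy' : U y') := (s' [::] y' Uy').2 j.
  have cd' y' (Uy' : U y') := (s' [:: j] y' Uy').1.
  by have [_ e] := avg_derive k' c' d' cd' Uy; exact: e.
Qed.

(** The fundamental theorem of calculus along the segment, where [phi] starts from 0 and has
    derivative [y_i * pderiv i phi]. If [y_i = 0] the segment is one point and the average is the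
    derivative there. *)
Lemma had_avg phi y : smooth_on U phi -> U y -> phi (scale_at i 0 y) = 0 ->
  had i phi y = avg_at i (pderiv i phi) 0 y.
Proof.
move=> s Uy phi0.
have c' y' (Uy' : U y') := (s [::] y' Uy').1.
have cd' y' (Uy' : U y') := (s [:: i] y' Uy').1.
rewrite /had /avg_at; case: eqP => [yi|/eqP yi].
  under eq_Rintegral do rewrite expr0 mul1r (scale_at_id _ yi).
  by rewrite Rintegral_cst ?fine01 ?mulr1//; exact: measurable_itv.
have dg t : 0 <= t <= 1 -> is_derive t 1 (fun t => phi (scale_at i t y))
    (y 0 i * pderiv i phi (scale_at i t y)).
  move=> t01; have Us := scale_at_ball r0 x0i t01 Uy.
  have e : (fun t' => phi (scale_at i t' y)) =
      (fun t' => phi (((t' - t) * y 0 i) *: evec R i + scale_at i t y)).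
    by apply/funext => t'; rewrite [in LHS](scale_at_shift _ _ t).
  rewrite e; exact: is_derive_affine t (y 0 i) (derivableP ((s [::] _ Us).2 i)).
have cg t (t01 : 0 <= t <= 1) := scale_at_continuous_s r0 x0i c' Uy t01.
have I0 : 0 <= (0 : R) <= 1 by rewrite lexx ler01.
have I1 : 0 <= (1 : R) <= 1 by rewrite lexx ler01.
have := @continuous_FTC2 R (fun t => y 0 i * pderiv i phi (scale_at i t y))
  (fun t => phi (scale_at i t y)) 0 1 ltr01.
rewrite scale_at1 phi0 sube0 => FTC.
suff <- : \int[lebesgue_measure]_(t in `[(0 : R), 1])
   (y 0 i * pderiv i phi (scale_at i t y)) = phi y.
  under [in RHS]eq_Rintegral do rewrite expr0 mul1r.
  have mI : measurable (`[(0 : R), 1]%classic : set (measurableTypeR R)).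
    exact: measurable_itv.
  have ii := avg_integrable r0 x0i cd' 0 Uy.
  have e : (fun t => t ^+ 0 * pderiv i phi (scale_at i t y)) =
      (fun t => pderiv i phi (scale_at i t y)).
    by apply/funext => t; rewrite expr0 mul1r.
  rewrite [iter_pderiv _ _]/= e in ii.
  by rewrite (RintegralZl _ mI ii) mulKf.
rewrite /Rintegral FTC//.
- apply: continuous_in_subspaceT => t; rewrite inE/= in_itv/= => t01.
  apply: (@continuousM _ _ (cst (y 0 i)) (fun t => pderiv i phi (scale_at i t y))).
    exact: cst_continuous.
  exact: (scale_at_continuous_s r0 x0i cd' Uy t01).
- split.
  + move=> t /[!in_itv]/= /andP[t0 t1].
    have t01 : 0 <= t <= 1 by rewrite !ltW.
    by have [] := dg t t01.
  + exact/cvg_at_right_filter/cg.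
  + exact/cvg_at_left_filter/cg.
- move=> t /[!in_itv]/= /andP[t0 t1]; rewrite derive1E.
  have t01 : 0 <= t <= 1 by rewrite !ltW.
  by have [_ ->] := dg t t01.
Qed.

End Averages.

Lemma smooth_had (R : realType) n (D : set 'rV[R]_n) phi i : open D -> smooth_on D phi ->
  (forall y, D y -> y 0 i = 0 -> phi y = 0) -> smooth_on D (had i phi).
Proof.
move=> oD s phi0; apply: smooth_on_local => x Dx.
have [xi|xi] := eqVneq (x 0 i) 0; last first.
  exists (D `&` [set y : 'rV[R]_n | y 0 i != 0]), (fun y : 'rV[R]_n => (y 0 i)^-1 * phi y).
  have oU : open (D `&` [set y : 'rV[R]_n | y 0 i != 0]).
    apply: openI => //; apply: (@open_comp _ _ (fun y : 'rV[R]_n => y 0 i) [set z | z != 0]).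
      by move=> y _; exact: coord_continuous.
    exact: open_neq.
  split => //.
    apply: smooth_on_quot => //; first by move=> y [].
    by apply: smooth_on_sub s => y [].
  by move=> y [_ /= /negPf yi]; rewrite /had yi.
move: (oD); rewrite openE => /(_ _ Dx); rewrite /interior => /nbhs_ballP[r /= r0 rD].
exists (ball x r), (avg_at i (pderiv i phi) 0).
have sU : smooth_on (ball x r) phi by exact: smooth_on_sub s.
split; [exact: (@ball_open R 'rV[R]_n)|exact: ballxx| |].
  by apply: avg_smooth => //; exact: smooth_on_pderiv.
move=> y Uy; apply: (had_avg r0 xi sU Uy).
have U0 : ball x r (scale_at i 0 y) by apply: scale_at_ball => //; rewrite lexx ler01.
by apply: phi0; [exact: rD|rewrite scale_atE eqxx mul0r].
Qed.

(** * Derivatives of algebra-valued curves *)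

Section HasReg.
Variables (R : realType) (n : nat) (p : regularity).
Implicit Types (D : set 'rV[R]_n) (phi : 'rV[R]_n -> R).

Lemma has_reg_cst0 D : has_reg p D (fun=> 0 : R).
Proof. by case: p; [exact: smooth_on_cst|exact: analytic_cst0]. Qed.

Lemma has_reg_derivable D phi x i : has_reg p D phi -> D x -> derivable phi x (evec R i).
Proof.
case: p => [s Dx|]; last exact: analytic_derivable.
by have [_] := s [::] x Dx; exact.
Qed.

Lemma has_reg_had D phi i : open D -> has_reg p D phi ->
  (forall y, D y -> y 0 i = 0 -> phi y = 0) -> has_reg p D (had i phi).
Proof. by case: p; [exact: smooth_had|exact: analytic_had]. Qed.

End HasReg.

Section AlgebraCalculus.
Variables (R : realType) (A : falgType R).
Implicit Types (x y a b : A) (phi psi : R -> A).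

Lemma acoordD j x y : acoord j (x + y) = acoord j x + acoord j y.
Proof. by rewrite /acoord linearD. Qed.

Lemma acoordN j x : acoord j (- x) = - acoord j x.
Proof. by rewrite /acoord linearN. Qed.

Lemma acoordZ j (r : R) x : acoord j (r *: x) = r * acoord j x.
Proof. by rewrite /acoord linearZ. Qed.

Lemma acoord_sum j I (s : seq I) (P : pred I) (F : I -> A) :
  acoord j (\sum_(k <- s | P k) F k) = \sum_(k <- s | P k) acoord j (F k).
Proof. by rewrite /acoord linear_sum. Qed.

Lemma acoord_basis j (c : 'I_(\dim {:A}) -> R) :
  acoord j (\sum_k c k *: (vbasis {:A})`_k) = c j.
Proof. by rewrite /acoord coord_sum_free ?(basis_free (vbasisP _)). Qed.

Lemma acoordK x : \sum_k acoord k x *: (vbasis {:A})`_k = x.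
Proof. by rewrite -(coord_vbasis (memvf x)). Qed.

Lemma acoord_inj x y : (forall j, acoord j x = acoord j y) -> x = y.
Proof. by move=> e; rewrite -(acoordK x) -(acoordK y); apply: eq_bigr => k _; rewrite e. Qed.

Lemma acoordM j a x :
  acoord j (a * x) = \sum_(k < \dim {:A}) acoord j (a * (vbasis {:A})`_k) * acoord k x.
Proof.
rewrite -{1}(acoordK x) mulr_sumr acoord_sum; apply: eq_bigr => k _.
by rewrite -scalerAr acoordZ mulrC.
Qed.

(** Always taken at time 0: a partial derivative at [x] is read on the curve
    [F (t *: evec R i + x)], so the rules below need no base point. *)
Definition aderive phi a :=
  forall j, is_derive (0 : R) (1 : R) (fun t => acoord j (phi t)) (acoord j a).

Lemma near_eq_aderive phi psi a : (\forall t \near (0 : R), phi t = psi t) ->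
  aderive phi a -> aderive psi a.
Proof. by move=> e d j; apply: near_eq_is_derive (d j); apply: filterS e => t ->. Qed.

Lemma aderiveD phi psi a b : aderive phi a -> aderive psi b ->
  aderive (fun t => phi t + psi t) (a + b).
Proof.
move=> da db j; rewrite acoordD; under eq_fun do rewrite acoordD.
by have := is_deriveD (da j) (db j).
Qed.

Lemma aderiveM c phi a : aderive phi a -> aderive (fun t => c * phi t) (c * a).
Proof.
move=> da j; rewrite acoordM.
have -> : (fun t => acoord j (c * phi t)) =
    \sum_(k < \dim {:A}) (fun t => acoord j (c * (vbasis {:A})`_k) * acoord k (phi t)).
  by apply/funext => t; rewrite acoordM fct_sumE.
apply: is_derive_sum => k.
by have := is_deriveZ (acoord j (c * (vbasis {:A})`_k)) (da k).
Qed.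

Lemma aderiveZ (rho : R -> R) d phi a : is_derive (0 : R) (1 : R) rho d -> aderive phi a ->
  aderive (fun t => rho t *: phi t) (rho 0 *: a + d *: phi 0).
Proof.
move=> dr da j; rewrite acoordD !acoordZ; under eq_fun do rewrite acoordZ.
have := is_deriveM dr (da j).
by rewrite /GRing.scale/= [acoord j (phi 0) * d]mulrC.
Qed.

Lemma aderiveZc (r : R) phi a : aderive phi a -> aderive (fun t => r *: phi t) (r *: a).
Proof.
move=> da; have := aderiveZ (is_derive_cst r (0 : R) (1 : R)) da.
by rewrite scale0r addr0.
Qed.

Lemma aderive_comp (rho : R -> R) d phi a : is_derive (0 : R) (1 : R) rho d -> rho 0 = 0 ->
  aderive phi a -> aderive (fun t => phi (rho t)) (d *: a).
Proof.
move=> dr r0 da j; rewrite acoordZ mulrC.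
apply: (@is_derive1_comp _ (fun t => acoord j (phi t)) rho) => //.
by rewrite r0; exact: da.
Qed.

Section Partial.
Variables (n : nat) (F : 'rV[R]_n -> A) (x : 'rV[R]_n) (i : 'I_n).

Lemma pderivA_aderive (p : regularity) (D : set 'rV[R]_n) : regA p D F -> D x ->
  aderive (fun t => F (t *: evec R i + x)) (pderivA i F x).
Proof.
move=> rF Dx j; rewrite /pderivA acoord_basis.
have d := derivableP (@has_reg_derivable _ _ p D _ x i (rF j) Dx).
by move/is_derive_line: d.
Qed.

(** The means of computing partial derivatives: exhibit the derivative of the curve. Those of [Ft]
    are all obtained in this way from its expression by [F] and [G]. *)
Lemma aderive_pderivA a : aderive (fun t => F (t *: evec R i + x)) a -> pderivA i F x = a.
Proof.
move=> d; apply: acoord_inj => j; rewrite /pderivA acoord_basis.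
have := (@is_derive_line R 'rV[R]_n (fun z => acoord j (F z)) x (evec R i) (acoord j a)).2.
by move=> /(_ (d j))[_ <-].
Qed.

End Partial.

Lemma near_line n (D : set 'rV[R]_n) (x : 'rV[R]_n) i (rho : R -> R) : open D -> D x ->
  rho @ (0 : R) --> (0 : R) -> \forall t \near (0 : R), D (rho t *: evec R i + x).
Proof.
move=> oD Dx r0.
have : (fun t : R => rho t *: evec R i + x) @ (0 : R) --> (0 : R) *: evec R i + x.
  by apply: cvgD; [apply: cvgZr_tmp|exact: cvg_cst].
rewrite scale0r add0r; apply; apply: open_nbhs_nbhs; split => //.
Qed.

End AlgebraCalculus.

(** * Products of anticommuting units *)

Section SetSplit.
Variable n : nat.
Implicit Types (K : {set 'I_n}) (h : 'I_n).

(** Here [ord0] is the torus factor absorbed by the larger mirror. The subsets of ['I_n.+1] are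
    exactly the [emb K] and the [ext K], so two components of [F] lie over each component of
    [Ft]. *)
Definition emb K : {set 'I_n.+1} := [set lift ord0 k | k in K].
Definition ext K : {set 'I_n.+1} := ord0 |: emb K.

Lemma in_emb0 K : (ord0 \in emb K) = false.
Proof. by apply/negP => /imsetP[k _ /eqP]; rewrite eq_liftF. Qed.

Lemma in_emb_lift K h : (lift ord0 h \in emb K) = (h \in K).
Proof. by rewrite mem_imset//; exact: lift_inj. Qed.

Lemma in_ext0 K : (ord0 \in ext K) = true.
Proof. by rewrite !inE. Qed.

Lemma in_ext_lift K h : (lift ord0 h \in ext K) = (h \in K).
Proof. by rewrite in_setU1 lift_eqF in_emb_lift. Qed.

Lemma ord_case (P : 'I_n.+1 -> Prop) : P ord0 -> (forall h, P (lift ord0 h)) ->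
  forall h : 'I_n.+1, P h.
Proof. by move=> P0 Pl h; case: (unliftP ord0 h) => [k|] ->. Qed.

Lemma card_emb K : #|emb K| = #|K|.
Proof. by rewrite card_imset//; exact: lift_inj. Qed.

Lemma card_ext K : #|ext K| = #|K|.+1.
Proof. by rewrite cardsU1 in_emb0 card_emb. Qed.

Lemma symdiff1_emb K h : symdiff1 (emb K) (lift ord0 h) = emb (symdiff1 K h).
Proof.
apply/setP; apply: ord_case => [|k]; rewrite /symdiff1 in_emb_lift; case: ifP => hK;
  by rewrite ?in_emb0 ?in_emb_lift !inE ?in_emb0 ?in_emb_lift ?(inj_eq (@lift_inj _ ord0)) ?andbF.
Qed.

Lemma symdiff1_ext K h : symdiff1 (ext K) (lift ord0 h) = ext (symdiff1 K h).
Proof.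
apply/setP; apply: ord_case => [|k]; rewrite /symdiff1 in_ext_lift; case: ifP => hK;
  rewrite ?in_ext0 ?in_ext_lift ?(in_setD1, in_setU1) ?in_ext0 ?in_ext_lift
    ?(inj_eq (@lift_inj _ ord0)) ?eq_liftF ?lift_eqF
    ?in_emb_lift ?orbT//.
Qed.

Lemma symdiff1_emb0 K : symdiff1 (emb K) ord0 = ext K.
Proof. by rewrite /symdiff1 in_emb0. Qed.

Lemma symdiff1_ext0 K : symdiff1 (ext K) ord0 = emb K.
Proof. by rewrite /symdiff1 in_ext0 /ext setU1K// in_emb0. Qed.

Lemma card_symdiff1 K h : odd #|symdiff1 K h| = ~~ odd #|K|.
Proof.
rewrite /symdiff1; case: ifP => hK; last by rewrite cardsU1 hK.
by rewrite [#|K|](cardsD1 h) hK /= negbK.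
Qed.

Lemma sigma_par_emb K h : sigma_par (lift ord0 h) (emb K) = sigma_par h K.
Proof.
rewrite /sigma_par -card_emb; congr #|pred_of_set _|; apply/setP.
by apply: ord_case => [|k]; rewrite inE ?in_emb0// !in_emb_lift inE.
Qed.

Lemma sigma_par_ext K h : sigma_par (lift ord0 h) (ext K) = (sigma_par h K).+1.
Proof.
rewrite /sigma_par -card_ext; congr #|pred_of_set _|; apply/setP.
by apply: ord_case => [|k]; rewrite inE ?in_ext0// !in_ext_lift inE.
Qed.

Lemma sigma_par_emb0 K : sigma_par ord0 (emb K) = 0%N.
Proof.
apply/eqP; rewrite cards_eq0; apply/eqP/setP.
by apply: ord_case => [|k]; rewrite !inE ?in_emb0// andbF.
Qed.

Lemma sigma_par_ext0 K : sigma_par ord0 (ext K) = 1%N.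
Proof.
rewrite /sigma_par -(cards1 (ord0 : 'I_n.+1)); congr #|pred_of_set _|; apply/setP.
by apply: ord_case => [|k]; rewrite !inE ?lift_eqF ?andbF ?eqxx.
Qed.

Lemma big_set_split (V : zmodType) (H : {set 'I_n.+1} -> V) :
  \sum_K H K = \sum_K H (emb K) + \sum_K H (ext K).
Proof.
pose pre (K : {set 'I_n.+1}) : {set 'I_n} := [set k : 'I_n | lift ord0 k \in K]%SET.
rewrite (bigID (fun K : {set 'I_n.+1} => ord0 \notin K))/=; congr +%R.
  rewrite (reindex_onto emb pre)/=; last first.
    move=> K K0; apply/setP; apply: ord_case => [|k]; last by rewrite in_emb_lift inE.
    by rewrite in_emb0 (negPf K0).
  apply: eq_bigl => K; rewrite in_emb0/=; apply/eqP/setP => k.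
  by rewrite inE in_emb_lift.
rewrite (reindex_onto ext pre)/=; last first.
  move=> K /negPn K0; apply/setP; apply: ord_case => [|k]; last by rewrite in_ext_lift inE.
  by rewrite in_ext0 K0.
apply: eq_bigl => K; rewrite in_ext0/=; apply/eqP/setP => k.
by rewrite inE in_ext_lift.
Qed.

End SetSplit.

Section UnitProducts.
Variables (R : realType) (A : falgType R).

Lemma JK_emb n (J : 'I_n.+1 -> A) K : JK J (emb K) = JK (fun h => J (lift ord0 h)) K.
Proof.
rewrite /JK big_mkcond big_ord_recl in_emb0 /= mul1r [RHS]big_mkcond.
by apply: eq_bigr => h _; rewrite in_emb_lift.
Qed.

Lemma JK_ext n (J : 'I_n.+1 -> A) K :
  JK J (ext K) = J ord0 * JK (fun h => J (lift ord0 h)) K.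
Proof.
rewrite /JK big_mkcond big_ord_recl in_ext0 /= [in RHS]big_mkcond; congr (_ * _).
by apply: eq_bigr => h _; rewrite in_ext_lift.
Qed.

Lemma JK_anticomm n (J : 'I_n -> A) K (a : A) : (forall h, a * J h = - (J h * a)) ->
  a * JK J K = (-1) ^+ #|K| *: (JK J K * a).
Proof.
move=> aJ; rewrite /JK -sum1_card.
elim/big_rec2: _ => [|h x N _ IH]; first by rewrite expr0 scale1r mul1r mulr1.
rewrite [LHS]mulrA aJ mulNr -[J h * a * x]mulrA IH -scalerAr add1n exprS mulN1r.
by rewrite scaleNr mulrA.
Qed.

(** Induction on the number of units. The two signs of the first unit give [a + J b = 0] and
    [a - J b = 0], hence [a = 0], and [b = 0] because [J] is invertible; [a] and [b] are sums of the
    same kind with one unit less. *)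
Lemma JK_separates n (J : 'I_n -> A) (X : {set 'I_n} -> A) :
  (forall h, J h * J h = -1) ->
  (forall e : 'I_n -> bool, \sum_K JK (fun h => (-1) ^+ e h *: J h) K * X K = 0) ->
  forall K, X K = 0.
Proof.
elim: n J X => [|n IH] J X JJ eX.
  have all0 (K L : {set 'I_0}) : K = L by apply/setP => -[].
  move=> K; have := eX (fun=> false); rewrite (bigD1 K)//= big1; last first.
    by move=> L; rewrite (all0 L K) eqxx.
  by rewrite addr0 /JK big_pred0 ?mul1r// => -[].
have key (e : 'I_n -> bool) :
    \sum_K JK (fun h => (-1) ^+ e h *: J (lift ord0 h)) K * X (emb K) = 0 /\
    \sum_K JK (fun h => (-1) ^+ e h *: J (lift ord0 h)) K * X (ext K) = 0.
  pose e' (b : bool) (h : 'I_n.+1) := if unlift ord0 h is Some k then e k else b.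
  have e'E b : (fun h => (-1) ^+ e' b (lift ord0 h) *: J (lift ord0 h)) =
               (fun h => (-1) ^+ e h *: J (lift ord0 h)).
    by apply/funext => h; rewrite /e' liftK.
  set a := \sum_K _; set b := \sum_K _.
  have E c : a + (-1) ^+ (c : bool) *: (J ord0 * b) = 0.
    rewrite -[RHS](eX (e' c)) big_set_split; congr +%R.
      by apply: eq_bigr => K _; rewrite JK_emb e'E.
    rewrite mulr_sumr scaler_sumr; apply: eq_bigr => K _.
    by rewrite JK_ext e'E /e' unlift_none -!scalerAl mulrA.
  have := E true; have := E false; rewrite expr0 expr1 scale1r scaleN1r => E1 E2.
  have a0 : a = 0.
    have : a + a = 0.
      by rewrite -[RHS](addr0 0) -{1}E1 -E2 addrACA subrr addr0.
    by move/eqP; rewrite -mulr2n -scaler_nat scaler_eq0 pnatr_eq0/= => /eqP.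
  split => //; move: E1; rewrite a0 add0r => /(congr1 (fun x => J ord0 * x)).
  by rewrite mulrA JJ mulN1r mulr0 => /eqP; rewrite oppr_eq0 => /eqP.
have JJ' h : J (lift ord0 h) * J (lift ord0 h) = -1 by exact: JJ.
have X1 := IH _ (fun K => X (emb K)) JJ' (fun e => (key e).1).
have X2 := IH _ (fun K => X (ext K)) JJ' (fun e => (key e).2).
move=> K; pose K' : {set 'I_n} := [set k : 'I_n | lift ord0 k \in K]%SET.
case: (boolP (ord0 \in K)) => K0.
  rewrite (_ : K = ext K') ?X2//; apply/setP; apply: ord_case => [|k].
    by rewrite in_ext0 K0.
  by rewrite in_ext_lift inE.
rewrite (_ : K = emb K') ?X1//; apply/setP; apply: ord_case => [|k].
  by rewrite in_emb0 (negPf K0).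
by rewrite in_emb_lift inE.
Qed.

End UnitProducts.

(** * The span of the units [v_s], and uniqueness of [alpha + beta J] *)

Section Vec.
Variables (R : realType) (A : falgType R) (N : nat) (v : nat -> A).
Implicit Types (x y : nat -> R).

(** Coefficients are indexed by [nat], so that vectors of different blocks [R_{l,m}] share one type
    and differ only by their support. *)
Definition vec x : A := \sum_(s < N.+1) x s *: v s.

Lemma vecD x y : vec (fun s => x s + y s) = vec x + vec y.
Proof. by rewrite /vec -big_split/=; apply: eq_bigr => s _; rewrite scalerDl. Qed.

Lemma vecZ (r : R) x : vec (fun s => r * x s) = r *: vec x.
Proof. by rewrite /vec scaler_sumr; apply: eq_bigr => s _; rewrite scalerA. Qed.

Lemma vec_sum n (x : 'I_n -> nat -> R) :
  vec (fun s => \sum_h x h s) = \sum_h vec (x h).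
Proof.
rewrite /vec exchange_big/=; apply: eq_bigr => s _.
by rewrite scaler_suml.
Qed.

Lemma eq_vec x y : (forall s, (s <= N)%N -> x s = y s) -> vec x = vec y.
Proof. by move=> e; apply: eq_bigr => s _; rewrite e// -ltnS. Qed.

Lemma big_nat_widen_ord (V : zmodType) (F : nat -> V) l m : (m <= N)%N ->
  \sum_(l <= s < m.+1) F s = \sum_(s < N.+1) (if (l <= s <= m)%N then F s else 0).
Proof.
move=> mN; rewrite (big_nat_widenl l 0%N)// (big_nat_widen _ _ N.+1)//.
by rewrite big_mkord big_mkcond/=; apply: eq_bigr => s _; rewrite ltnS.
Qed.

Definition supp l m x := forall s, ~~ (l <= s <= m)%N -> x s = 0.

Lemma inSph_vec l m J : (m <= N)%N -> inSph v l m J ->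
  exists x, [/\ J = vec x, \sum_(s < N.+1) x s ^+ 2 = 1 & supp l m x].
Proof.
move=> mN [y [-> y1]]; exists (fun s => if (l <= s <= m)%N then y s else 0); split.
- rewrite big_nat_widen_ord//; apply: eq_bigr => s _.
  by case: ifP; rewrite ?scale0r.
- rewrite -y1 [RHS]big_nat_widen_ord//; apply: eq_bigr => s _.
  by case: ifP; rewrite ?expr0n.
- by move=> s /negPf ->.
Qed.

Lemma inSphN l m J : inSph v l m J -> inSph v l m (- J).
Proof.
move=> [y [-> y1]]; exists (fun s => - y s); split.
  by rewrite -sumrN; apply: eq_bigr => s _; rewrite scaleNr.
by under eq_bigr do rewrite sqrrN.
Qed.

Variable conj : A -> A.
Hypothesis bh : basis_hyp conj N v.

Lemma vec_inj x y : vec x = vec y -> forall s, (s <= N)%N -> x s = y s.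
Proof.
have [_ fr _ _ _] := bh => e s sN.
pose X : N.+1.-tuple A := Tuple (introT eqP (size_mkseq v N.+1)).
have /freeP/(_ (fun i => x i - y i)) : free X by [].
have -> : \sum_(i < N.+1) (x i - y i) *: X`_i = vec x - vec y.
  rewrite /vec -sumrB; apply: eq_bigr => i _; rewrite nth_mkseq//.
  by rewrite scalerBl.
rewrite e subrr => /(_ erefl (Ordinal (sN : (s < N.+1)%N)))/= /eqP.
by rewrite subr_eq0 => /eqP.
Qed.

Lemma unit_sqr s : (1 <= s <= N)%N -> v s * v s = -1.
Proof.
have [_ _ iu _ _] := bh => /iu[/eqP]; rewrite addrC addr_eq0 => /eqP ->.
by rewrite mulrN => /eqP; rewrite eqr_oppLR => /eqP.
Qed.

Lemma unit_anticomm s s' : (1 <= s <= N)%N -> (1 <= s' <= N)%N ->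
  v s * v s' + v s' * v s = (- (2 * (s == s')%:R)) *: (1 : A).
Proof.
have [_ _ _ ac _] := bh => /andP[s1 sN] /andP[s1' sN'].
case: ltngtP => [ss'|ss'|->].
- by rewrite ac// addNr mulr0 oppr0 scale0r.
- by rewrite (ac s' s)// addrN mulr0 oppr0 scale0r.
- rewrite unit_sqr ?s1'// mulr1 scaleNr scaler_nat.
  by rewrite mulr2n opprD.
Qed.

(** The polarised form of [x^2 = - |x|^2]. Vanishing 0-th coefficients exclude the central element
    [v 0 = 1], which anticommutes with nothing here. *)
Lemma vec_anticomm x y : x 0%N = 0 -> y 0%N = 0 ->
  vec x * vec y + vec y * vec x = (- (2 * \sum_(s < N.+1) x s * y s)) *: (1 : A).
Proof.
move=> x0 y0; rewrite /vec mulr_suml [X in _ + X]mulr_sumr -big_split/=.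
rewrite mulr_sumr -sumrN scaler_suml; apply: eq_bigr => s _.
rewrite mulr_sumr mulr_suml -big_split/=.
transitivity (\sum_(s' < N.+1) (- (2 * ((s : nat) == s')%:R * (x s * y s'))) *: (1 : A)).
  apply: eq_bigr => s' _.
  have sM (a b : R) (c d : A) : (a *: c) * (b *: d) = (a * b) *: (c * d).
    by rewrite -scalerAl -scalerAr scalerA.
  rewrite !sM [y s' * _]mulrC -scalerDr.
  have [->|s0] := posnP s; first by rewrite x0 !(mul0r, mulr0) oppr0 !scale0r.
  have [->|s0'] := posnP s'; first by rewrite y0 !mulr0 oppr0 !scale0r.
  rewrite unit_anticomm ?s0 ?s0' -1?ltnS ?ltn_ord// scalerA.
  by congr (_ *: _); ring.
rewrite (bigD1 s)//= eqxx big1 ?addr0 ?mulr1// => s' /negPf.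
rewrite -val_eqE/= eq_sym => ->.
by rewrite mulr0 mul0r oppr0 scale0r.
Qed.

Lemma vec_sqr x : x 0%N = 0 ->
  vec x * vec x = (- \sum_(s < N.+1) x s ^+ 2) *: (1 : A).
Proof.
move=> x0; have := vec_anticomm x0 x0.
rewrite -mulr2n -scaler_nat => /(congr1 (fun z => (2%:R : R)^-1 *: z)).
rewrite !scalerA mulVf ?pnatr_eq0// scale1r => ->; congr (_ *: _).
by rewrite mulrN mulrA mulVf ?pnatr_eq0// mul1r.
Qed.

Lemma inSph_sqr l m J : (0 < l)%N -> (m <= N)%N -> inSph v l m J -> J * J = -1.
Proof.
move=> l0 mN /(inSph_vec mN)[x [-> x1 sx]]; rewrite vec_sqr ?x1 ?scaleN1r//.
by apply: sx; rewrite leqn0 gtn_eqF.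
Qed.

Lemma inSph_anticomm l m J l' m' J' : (0 < l)%N -> (m < l')%N -> (m' <= N)%N ->
  inSph v l m J -> inSph v l' m' J' -> J * J' = - (J' * J).
Proof.
move=> l0 ml' mN'; have [lm'|] := leqP l' m'; last first.
  (* An empty range contains no unit vector: the sum of squares would be 0 instead of 1. *)
  move=> lm _ [y [_]]; rewrite big_geq// => /eqP; rewrite eq_sym oner_eq0//.
have mN : (m <= N)%N by lia.
move=> /(inSph_vec mN)[x [-> _ sx]] /(inSph_vec mN')[y [-> _ sy]].
apply/eqP; rewrite -addr_eq0 vec_anticomm.
- rewrite big1 ?mulr0 ?oppr0 ?scale0r// => s _.
  have [sm|ms] := leqP s m; first by rewrite [y s]sy ?mulr0//; lia.
  by rewrite [x s]sx ?mul0r//; lia.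
- by apply: sx; lia.
- by apply: sy; lia.
Qed.

Lemma unit_inSph_anticomm k l m J : (0 < k)%N -> (k < l)%N -> (m <= N)%N ->
  inSph v l m J -> J * v k = - (v k * J).
Proof.
move=> k0 kl mN SJ; apply: oppr_inj; rewrite opprK; apply/esym.
apply: (@inSph_anticomm k k (v k) l m J) => //.
exists (fun=> 1); rewrite !big_nat1 scale1r; split => //.
by rewrite expr1n.
Qed.

Section Points.
Variables (t0 tau : nat) (t : nat -> nat).
Hypotheses (tE : t 0%N = t0) (tS : forall i, (i < tau)%N -> (t i < t i.+1)%N)
  (tN : t tau = N).

Lemma steps_le i j : (i <= j <= tau)%N -> (t i <= t j)%N.
Proof.
move=> /andP[ij jt]; elim: j ij jt => [|j IH]; first by rewrite leqn0 => /eqP ->.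
rewrite leq_eqVlt ltnS => /predU1P[->//|ij] jt.
by apply: leq_trans (IH ij (ltnW jt)) (ltnW (tS jt)).
Qed.

Lemma steps_leN i : (i <= tau)%N -> (t i <= N)%N.
Proof. by move=> it; rewrite -tN; apply: steps_le; rewrite it leqnn. Qed.

Lemma torus_sqr (J : 'I_tau -> A) h : torus v t J -> J h * J h = -1.
Proof. by move=> /(_ h); apply: inSph_sqr => //; exact: steps_leN. Qed.

Lemma torus_vec (J : 'I_tau -> A) : torus v t J ->
  exists X : 'I_tau -> nat -> R,
    forall h, J h = vec (X h) /\ supp (t h).+1 (t h.+1) (X h).
Proof.
move=> TJ; have /boolp.choice[X XE] : forall h, exists X,
    J h = vec X /\ supp (t h).+1 (t h.+1) X; last by exists X.
move=> h; have [X [? _ ?]] := inSph_vec (steps_leN (ltn_ord h)) (TJ h).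
by exists X.
Qed.

Definition alpha_ext (w : 'rV[R]_(t0.+1 + tau)) (s : nat) : R :=
  if insub s is Some j then alpha_c w j else 0.

Lemma pt_vec (w : 'rV[R]_(t0.+1 + tau)) (J : 'I_tau -> A) X :
  (forall h, J h = vec (X h)) ->
  pt v w J = vec (fun s => alpha_ext w s + \sum_h beta_c w h * X h s).
Proof.
move=> JX; rewrite vecD vec_sum /pt; congr +%R; last first.
  by apply: eq_bigr => h _; rewrite vecZ JX.
have t0N : (t0.+1 <= N.+1)%N by rewrite ltnS -tE; exact: steps_leN.
transitivity (\sum_(s < t0.+1) alpha_ext w s *: v s).
  by apply: eq_bigr => s _; rewrite /alpha_ext valK.
rewrite (big_ord_widen _ (fun s => alpha_ext w s *: v s) t0N) big_mkcond/=.
apply: eq_bigr => s _; case: ifPn => // st0.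
by rewrite /alpha_ext insubN// scale0r.
Qed.

(** The steps cut the coordinates into disjoint blocks, and each summand is read off its own block.
    Only the product [beta_h J_h] is determined: the sign can be moved between its factors, and
    [J_h] is free where [beta_h = 0]. *)
Lemma pt_inj (w w0 : 'rV[R]_(t0.+1 + tau)) (J J0 : 'I_tau -> A) :
  torus v t J -> torus v t J0 -> pt v w J = pt v w0 J0 ->
  (forall s, alpha_c w s = alpha_c w0 s) /\
  (forall h, beta_c w h *: J h = beta_c w0 h *: J0 h).
Proof.
move=> /torus_vec[X XE] /torus_vec[X0 X0E].
rewrite (pt_vec _ (fun h => (XE h).1)) (pt_vec _ (fun h => (X0E h).1)).
move=> /vec_inj e; split=> [s|h].
  have st : (s <= t 0%N)%N by rewrite tE -ltnS.
  have := e s (leq_trans st (steps_leN (leq0n _))).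
  rewrite /alpha_ext valK !big1 ?addr0// => h _; have := steps_le (i := 0) (ltnW (ltn_ord h)) => th.
    by rewrite (X0E h).2 ?mulr0//; lia.
  by rewrite (XE h).2 ?mulr0//; lia.
rewrite (XE h).1 (X0E h).1 -!vecZ; apply: eq_vec => s sN.
have [sh|sh] := boolP ((t h).+1 <= s <= t h.+1)%N; last first.
  by rewrite (XE h).2// (X0E h).2// !mulr0.
have := e s sN; have th := steps_le (i := 0) (ltnW (ltn_ord h)).
have ns : ~~ (s < t0.+1)%N by rewrite -tE; lia.
have hh (h' : 'I_tau) : h' != h -> ~~ ((t h').+1 <= s <= t h'.+1)%N.
  rewrite -val_eqE neq_ltn => /orP[hh'|hh'].
    by have := @steps_le h'.+1 h; rewrite hh' (ltnW (ltn_ord h)) => /(_ isT); lia.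
  by have := @steps_le h.+1 h'; rewrite hh' (ltnW (ltn_ord h')) => /(_ isT); lia.
rewrite /alpha_ext insubN// !add0r (bigD1 h)//= [in RHS](bigD1 h)//=.
by rewrite !big1 ?addr0// => h' /hh nh; rewrite ?(XE h').2 ?(X0E h').2 ?mulr0.
Qed.

End Points.
End Vec.

(** * Stem functions *)

Section Stems.
Variables (R : realType) (A : falgType R) (t0 tau : nat).
Variable D : set 'rV[R]_(t0.+1 + tau).
Hypotheses (oD : open D) (rD : refl_inv D).
Implicit Types (K : {set 'I_tau}) (F H : {set 'I_tau} -> 'rV[R]_(t0.+1 + tau) -> A)
  (w : 'rV[R]_(t0.+1 + tau)) (h : 'I_tau).

Lemma is_stemE F : is_stem D F <->
  forall K h w, D w -> F K (bflip h w) = (-1) ^+ (h \in K) *: F K w.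
Proof.
by split=> s K h w Dw; rewrite s//; case: (h \in K); rewrite ?expr1 ?scaleN1r ?expr0 ?scale1r.
Qed.

Lemma bflipE h w j : bflip h w 0 j = (-1) ^+ (j == rshift t0.+1 h) * w 0 j.
Proof. by rewrite mxE; case: eqP; rewrite ?expr1 ?mulN1r ?expr0 ?mul1r. Qed.

Lemma bflip_line h i (r : R) w :
  bflip h (r *: evec R i + w) = ((-1) ^+ (i == rshift t0.+1 h) * r) *: evec R i + bflip h w.
Proof.
apply/rowP => j; rewrite [RHS]mxE !bflipE !mxE eqxx /= mulrDr; congr +%R.
by have [->|_] := eqVneq j i; rewrite ?mulr1 ?mulr0.
Qed.

Lemma foldr_bflip_alpha l w s : alpha_c (foldr (@bflip R t0 tau) w l) s = alpha_c w s.
Proof.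
rewrite /alpha_c; elim: l => //= h l IH.
by rewrite bflipE eq_lrshift mul1r.
Qed.

Lemma foldr_bflip_beta l w h : uniq l ->
  beta_c (foldr (@bflip R t0 tau) w l) h = (-1) ^+ (h \in l) * beta_c w h.
Proof.
rewrite /beta_c; elim: l => [|k l IH] /=; first by rewrite mul1r.
move=> /andP[kl ul]; rewrite bflipE eq_rshift IH// in_cons.
have [->|hk] := eqVneq h k; last by rewrite mul1r.
by rewrite (negPf kl)/= mul1r.
Qed.

Lemma stem_foldr_bflip H K l w : is_stem D H -> D w ->
  D (foldr (@bflip R t0 tau) w l) /\
  H K (foldr (@bflip R t0 tau) w l) = (\prod_(h <- l) (-1) ^+ (h \in K)) *: H K w.
Proof.
move=> /is_stemE sH Dw; elim: l => [|h l [IH1 IH2]] /=; first by rewrite big_nil scale1r.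
by split; [exact: rD|rewrite sH// IH2 big_cons scalerA].
Qed.

Lemma stem_beta0 H K w h : is_stem D H -> D w -> h \in K -> beta_c w h = 0 -> H K w = 0.
Proof.
move=> /is_stemE sH Dw hK b0; have := sH K h w Dw.
have -> : bflip h w = w.
  apply/rowP => j; rewrite bflipE; case: eqP => [->|_]; last by rewrite mul1r.
  by rewrite -/(beta_c w h) b0 mulr0.
rewrite hK expr1 scaleN1r => /eqP.
by rewrite -addr_eq0 -mulr2n -scaler_nat scaler_eq0 pnatr_eq0/= => /eqP.
Qed.

(** Squaring [beta_h J_h] shows that the two [beta_h] agree up to sign, so [w0] arises from [w] by
    reflections. The signs these produce in [J_K] and in [H_K] cancel. *)
Lemma stem_well_defined H (J J0 : 'I_tau -> A) w w0 : is_stem D H -> D w -> D w0 ->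
  (forall h, J h * J h = -1) -> (forall h, J0 h * J0 h = -1) ->
  (forall s, alpha_c w s = alpha_c w0 s) ->
  (forall h, beta_c w h *: J h = beta_c w0 h *: J0 h) ->
  IF_at J H w = IF_at J0 H w0.
Proof.
move=> sH Dw Dw0 JJ JJ0 ae be.
have sqb h : beta_c w h ^+ 2 = beta_c w0 h ^+ 2.
  have sq (b : R) (X : A) : X * X = -1 -> (b *: X) * (b *: X) = (- b ^+ 2) *: 1.
    by move=> XX; rewrite -scalerAl -scalerAr XX scalerA scalerN scaleNr.
  have : (- beta_c w h ^+ 2) *: (1 : A) = (- beta_c w0 h ^+ 2) *: 1.
    by rewrite -(sq (beta_c w h) (J h) (JJ h)) be (sq _ _ (JJ0 h)).
  move/eqP; rewrite -subr_eq0 -scalerBl scaler_eq0 oner_eq0 orbF subr_eq0 eqr_opp.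
  by move/eqP.
pose e h := beta_c w0 h != beta_c w h.
have eE h : beta_c w0 h = (-1) ^+ e h * beta_c w h.
  rewrite /e; have [->|ne] := eqVneq; first by rewrite mul1r.
  have /eqP := sqb h; rewrite eqf_sqr eq_sym (negPf ne)/= => /eqP ->.
  by rewrite expr1 mulN1r opprK.
pose l := [seq h <- enum 'I_tau | e h].
have ul : uniq l by rewrite filter_uniq// enum_uniq.
have lE h : (h \in l) = e h by rewrite mem_filter mem_enum andbT.
have w0E : w0 = foldr (@bflip R t0 tau) w l.
  apply/rowP => j; rewrite -(splitK j); case: (fintype.split j) => [s|h] /=.
    exact: (etrans (esym (ae s)) (esym (foldr_bflip_alpha l w s))).
  by have := foldr_bflip_beta w h ul; rewrite lE -eE => /esym.
apply: eq_bigr => K _.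
(* If some [beta_h] with [h] in [K] is 0, then [J h] and [J0 h] are unrelated, but [H K] vanishes at
   both points by oddness. *)
have [Hz|nz] := boolP [exists h in K, beta_c w h == 0].
  have /existsP[h /andP[hK /eqP b0]] := Hz.
  rewrite (stem_beta0 sH Dw hK b0) (stem_beta0 sH Dw0 hK) ?mulr0//.
  by rewrite eE b0 mulr0.
have bn0 h : h \in K -> beta_c w h != 0.
  by move=> hK; apply: contra nz => b0; apply/existsP; exists h; rewrite hK.
rewrite w0E (stem_foldr_bflip K l sH Dw).2.
have -> : JK J K = (\prod_(h in K) (-1) ^+ e h) *: JK J0 K.
  rewrite /JK -scaler_prod; apply: eq_bigr => h hK.
  have := be h; rewrite eE mulrC -scalerA => /(scalerI (bn0 _ hK)).
  by [].
rewrite -scalerAl -scalerAr; congr (_ *: _).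
rewrite big_filter big_enum_cond/= big_mkcond [RHS]big_mkcond/=.
by apply: eq_bigr => h _; case: (e h); case: (h \in K).
Qed.

(** The line through [bflip h w] in direction [i] is the reflection of a line through [w], run
    backwards exactly when [i] is the coordinate [beta_h]. That gives the first sign; the parity of
    [F K] gives the second. *)
Lemma pderivA_bflip (p : regularity) F K h i w : is_stem D F -> regA p D (F K) -> D w ->
  pderivA i (F K) (bflip h w) =
  (-1) ^+ (i == rshift t0.+1 h) *: ((-1) ^+ (h \in K) *: pderivA i (F K) w).
Proof.
move=> /is_stemE sF rF Dw; apply: aderive_pderivA.
set e := (-1) ^+ (i == rshift t0.+1 h).
have ee : e * e = 1 by rewrite -expr2 sqrr_sign.
have de : is_derive (0 : R) (1 : R) (fun t : R => e * t) e.
  have := is_deriveZ e (is_derive_id (0 : R) (1 : R)).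
  by rewrite [_ *: _]mulr1.
apply: near_eq_aderive (aderive_comp de (mulr0 _) (aderiveZc ((-1) ^+ (h \in K))
   (pderivA_aderive i rF Dw))).
have e0 : (fun t : R => e * t) @ (0 : R) --> (0 : R).
  by rewrite -[X in _ --> X](mulr0 e); apply: cvgMl_tmp; exact: cvg_id.
have := near_line i oD Dw e0; apply: filterS => r Dr.
by rewrite -sF// bflip_line -/e mulrA ee mul1r.
Qed.

Lemma is_stem_pderivA_alpha (p : regularity) F s : stem_reg p D F ->
  is_stem D (fun K => pderivA (lshift tau s) (F K)).
Proof.
move=> [sF rF]; apply/is_stemE => K h w Dw.
by rewrite (pderivA_bflip h _ sF (rF K) Dw) eq_lrshift scale1r.
Qed.

(** In the term with [h = k], reflection changes the sign of the derivative, and membership of [h]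
    changes between [K] and [symdiff1 K h]. The two effects compensate, so every term has the parity
    of [K]. *)
Lemma is_stem_dbarT (p : regularity) (v : nat -> A) F : stem_reg p D F ->
  is_stem D (dbarT v F).
Proof.
move=> [sF rF]; apply/is_stemE => K h w Dw; rewrite /dbarT /dalpha.
have aE s : pderivA (lshift tau s) (F K) (bflip h w) =
    (-1) ^+ (h \in K) *: pderivA (lshift tau s) (F K) w.
  by rewrite (pderivA_bflip h _ sF (rF K) Dw) eq_lrshift scale1r.
rewrite aE scalerDr; congr +%R.
  rewrite scalerBr; congr (_ - _); rewrite scalerAr; congr (_ * _).
  by rewrite scaler_sumr; apply: eq_bigr => s _; rewrite aE scalerAr.
rewrite scaler_sumr; apply: eq_bigr => k _; rewrite scalerAr; congr (_ * _).
rewrite (pderivA_bflip h _ sF (rF _) Dw) scalerA; congr (_ *: _).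
rewrite eq_rshift /symdiff1 -signr_addb; congr (_ ^+ nat_of_bool _).
by case: (boolP (k \in K)) => kK; rewrite !inE eq_sym; case: eqP => [->|_] //=; rewrite ?kK ?(negPf kK).
Qed.

Lemma dTE (v : nat -> A) F K w :
  dT v F K w = 2%:R *: pderivA (lshift tau ord0) (F K) w - dbarT v F K w.
Proof.
rewrite /dT /dbarT /dalpha exprS mulN1r mulNr opprK scaler_nat mulr2n.
under [X in _ - (_ + X)]eq_bigr do rewrite exprS mulN1r mulNr.
rewrite sumrN opprD opprK addrA; congr +%R.
by rewrite opprD addrA addrK.
Qed.

End Stems.

(** * Enlarging the mirror *)

Section QuotientStem.
Variables (R : realType) (A : falgType R) (t0 n : nat).
Variable D : set 'rV[R]_(t0.+1 + n.+1).
Hypotheses (oD : open D) (rD : refl_inv D).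
Variables (p : regularity) (F : {set 'I_n.+1} -> 'rV[R]_(t0.+1 + n.+1) -> A).
Hypothesis srF : stem_reg p D F.
Implicit Types (K : {set 'I_n.+1}) (w : 'rV[R]_(t0.+1 + n.+1)) (h : 'I_n.+1).

Let b1 : 'I_(t0.+1 + n.+1) := rshift t0.+1 ord0.

Definition quot_stem K w : A :=
  if ord0 \in K then 0
  else if w 0 b1 == 0 then pderivA b1 (F (ord0 |: K)) w
  else (w 0 b1)^-1 *: F (ord0 |: K) w.

Lemma quot_stem_is_stem : is_stem D quot_stem.
Proof.
have [sF rF] := srF; have sF' := (is_stemE _ _).1 sF.
apply/is_stemE => K h w Dw; rewrite /quot_stem; case: ifPn => [|K0].
  by rewrite scaler0.
rewrite bflipE mulrI_eq0; last by apply: lregX; exact: lregN (@lreg1 _).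
case: eqP => [w0|/eqP w0].
  rewrite (pderivA_bflip oD h _ sF (rF _) Dw) !scalerA -signr_addb.
  congr ((-1) ^+ nat_of_bool _ *: _); rewrite eq_rshift in_setU1.
  by have [->|_] := eqVneq h ord0; rewrite ?(negPf K0).
rewrite sF'// invfM scalerA -mulrA [_ * (-1) ^+ _]mulrC mulrA scalerA; congr (_ * _ *: _).
rewrite invr_sign -signr_addb eq_rshift in_setU1 eq_sym.
by have [->|_] := eqVneq h ord0; rewrite ?(negPf K0).
Qed.

Lemma quot_stem_reg : stem_reg p D quot_stem.
Proof.
split=> [|K j]; first exact: quot_stem_is_stem.
have [sF rF] := srF; rewrite /quot_stem; case: (boolP (ord0 \in K)) => K0.
  have -> : (fun=> acoord j (0 : A)) = (fun=> 0) :> ('rV[R]_(t0.+1 + n.+1) -> R).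
    by apply/funext => y; rewrite /acoord linear0.
  exact: has_reg_cst0.
have -> : (fun y : 'rV[R]_(t0.+1 + n.+1) => acoord j (if y 0 b1 == 0
     then pderivA b1 (F (ord0 |: K)) y else (y 0 b1)^-1 *: F (ord0 |: K) y)) =
   had b1 (fun y => acoord j (F (ord0 |: K) y)).
  apply/funext => y; rewrite /had; case: ifP => _; last by rewrite acoordZ.
  by rewrite /pderivA acoord_basis.
apply: (has_reg_had oD (rF _ j)) => y Dy y0.
rewrite (stem_beta0 sF Dy (setU11 _ _) y0).
by rewrite /acoord linear0.
Qed.

(** Valid on [beta_1 = 0] as well, where [F (ext K)] vanishes by oddness. Differentiating this
    product avoids treating the hyperplane apart. *)
Lemma quot_stemM (K : {set 'I_n}) w : D w -> w 0 b1 *: quot_stem (emb K) w = F (ext K) w.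
Proof.
move=> Dw; rewrite /quot_stem in_emb0 -/(ext K); case: eqP => [w0|/eqP w0].
  by rewrite w0 scale0r (stem_beta0 srF.1 Dw _ w0)// in_ext0.
by rewrite scalerA divff// scale1r.
Qed.

End QuotientStem.

(** * How the contracted point moves along coordinate lines *)

Section Contract.
Variables (R : realType) (A : falgType R) (v : nat -> A) (t0 t1 n : nat).
Hypothesis t01 : (t0 < t1)%N.
Implicit Types (w : 'rV[R]_(t1.+1 + n)).

Let b1 : 'I_(t0.+1 + n.+1) := rshift t0.+1 ord0.
Let le01 : (t0.+1 <= t1.+1)%N := ltnW t01.

Notation ctr := (@contractD R t0 t1 n.+1 n).

Definition alift (s : 'I_t0.+1) : 'I_(t1.+1 + n) := lshift n (widen_ord le01 s).
Definition blift (h : 'I_n) : 'I_(t0.+1 + n.+1) := rshift t0.+1 (lift ord0 h).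

(** The square of [|x1|], where [x1], given by [xone], is the part of the point carried by the units
    that enter the larger mirror. *)
Definition nsq w : R := \sum_(s < t1.+1 | (t0 < s)%N) w 0 (lshift n s) ^+ 2.
Definition xone w : A := \sum_(s < t1.+1 | (t0 < s)%N) w 0 (lshift n s) *: v s.

Lemma rget_ord k (u : 'rV[R]_k) (j : 'I_k) : rget u j = u 0 j.
Proof. by rewrite /rget (big_pred1 j). Qed.

Lemma contract_alpha w s : ctr w 0 (lshift n.+1 s) = w 0 (alift s).
Proof.
rewrite mxE (unsplitK (inl s)).
by rewrite (rget_ord (lsubmx w) (widen_ord le01 s)) mxE.
Qed.

Lemma contract_beta0 w : ctr w 0 b1 = Num.sqrt (nsq w).
Proof.
rewrite mxE (unsplitK (inr ord0))/=; congr Num.sqrt.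
by apply: eq_bigr => s _; rewrite mxE.
Qed.

Lemma contract_betaS w h : ctr w 0 (blift h) = w 0 (rshift t1.+1 h).
Proof. by rewrite mxE (unsplitK (inr (lift ord0 h)))/= rget_ord mxE. Qed.

Lemma contract_rowP (u1 u2 : 'rV[R]_(t0.+1 + n.+1)) :
  (forall s, u1 0 (lshift n.+1 s) = u2 0 (lshift n.+1 s)) -> u1 0 b1 = u2 0 b1 ->
  (forall h, u1 0 (blift h) = u2 0 (blift h)) -> u1 = u2.
Proof.
move=> ea e0 eS; apply/rowP => j; rewrite -(splitK j).
case: (fintype.split j) => [s|] /=; first exact: ea.
exact: ord_case.
Qed.

Lemma line_coord k (i j : 'I_k) (r : R) (u : 'rV[R]_k) :
  (r *: evec R i + u) 0 j = r * (j == i)%:R + u 0 j.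
Proof. by rewrite !mxE. Qed.

Lemma nsq_line_alpha w s r : nsq (r *: evec R (alift s) + w) = nsq w.
Proof.
apply: eq_bigr => k kt; rewrite line_coord eq_lshift.
have -> : (k == widen_ord le01 s) = false.
  by apply/negP => /eqP e; move: kt (ltn_ord s); rewrite e /=; lia.
by rewrite mulr0 add0r.
Qed.

Lemma xone_line_alpha w s r : xone (r *: evec R (alift s) + w) = xone w.
Proof.
apply: eq_bigr => k kt; rewrite line_coord eq_lshift.
have -> : (k == widen_ord le01 s) = false.
  by apply/negP => /eqP e; move: kt (ltn_ord s); rewrite e /=; lia.
by rewrite mulr0 add0r.
Qed.

Lemma nsq_line_beta w h r : nsq (r *: evec R (rshift t1.+1 h) + w) = nsq w.
Proof. by apply: eq_bigr => k kt; rewrite line_coord eq_lrshift mulr0 add0r. Qed.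

Lemma xone_line_beta w h r : xone (r *: evec R (rshift t1.+1 h) + w) = xone w.
Proof. by apply: eq_bigr => k kt; rewrite line_coord eq_lrshift mulr0 add0r. Qed.

Lemma contract_line_alpha w s r :
  ctr (r *: evec R (alift s) + w) = r *: evec R (lshift n.+1 s) + ctr w.
Proof.
apply: contract_rowP => [k||h]; rewrite line_coord.
- rewrite !contract_alpha line_coord !eq_lshift; congr (_ * _%:R + _).
- by rewrite !contract_beta0 nsq_line_alpha eq_rlshift mulr0 add0r.
- by rewrite !contract_betaS line_coord !eq_rlshift !mulr0.
Qed.

Lemma contract_line_beta w h r :
  ctr (r *: evec R (rshift t1.+1 h) + w) = r *: evec R (blift h) + ctr w.
Proof.
apply: contract_rowP => [k||k]; rewrite line_coord.
- by rewrite !contract_alpha line_coord !eq_lrshift !mulr0.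
- by rewrite !contract_beta0 nsq_line_beta eq_rshift eq_liftF mulr0 add0r.
- by rewrite !contract_betaS line_coord !eq_rshift (inj_eq (@lift_inj _ ord0)).
Qed.

Section OneDirection.
Variable s : 'I_t1.+1.
Hypothesis ts : (t0 < s)%N.

Lemma nsq_line w r : nsq (r *: evec R (lshift n s) + w) =
  nsq w + 2 * r * w 0 (lshift n s) + r ^+ 2.
Proof.
rewrite /nsq (bigD1 s)//= [X in _ = X + _ + _](bigD1 s)//= line_coord eqxx.
rewrite (eq_bigr (fun k => w 0 (lshift n k) ^+ 2)); first by rewrite mulr1; ring.
by move=> k /andP[_ /negPf ks]; rewrite line_coord eq_lshift ks mulr0 add0r.
Qed.

Lemma xone_line w r : xone (r *: evec R (lshift n s) + w) = xone w + r *: v s.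
Proof.
rewrite /xone (bigD1 s)//= [X in _ = X + _](bigD1 s)//= line_coord eqxx mulr1.
rewrite (eq_bigr (fun k => w 0 (lshift n k) *: v k)); last first.
  by move=> k /andP[_ /negPf ks]; rewrite line_coord eq_lshift ks mulr0 add0r.
by rewrite scalerDl -addrA addrC.
Qed.

(** A move along a new mirror unit is seen downstairs only in [beta_1], through the increment of
    [|x1|]; all non-smoothness of the contraction sits in this square root. *)
Lemma contract_line w r : ctr (r *: evec R (lshift n s) + w) =
  (Num.sqrt (nsq w + 2 * r * w 0 (lshift n s) + r ^+ 2) - Num.sqrt (nsq w))
    *: evec R b1 + ctr w.
Proof.
apply: contract_rowP => [k||h]; rewrite line_coord.
- rewrite !contract_alpha line_coord eq_lrshift eq_lshift mulr0 add0r.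
  have -> : (widen_ord le01 k == s) = false.
    by apply/negP => /eqP e; move: ts (ltn_ord k); rewrite -e /=; lia.
  by rewrite mulr0 add0r.
- by rewrite !contract_beta0 eqxx mulr1 nsq_line subrK.
- by rewrite !contract_betaS line_coord eq_rshift lift_eqF eq_rlshift !mulr0 !add0r.
Qed.

End OneDirection.

Lemma nsq_ge0 w : 0 <= nsq w.
Proof. by apply: sumr_ge0 => s _; rewrite sqr_ge0. Qed.

Lemma nsq_eq0 w : nsq w = 0 -> forall s : 'I_t1.+1, (t0 < s)%N -> w 0 (lshift n s) = 0.
Proof.
move=> q0 s ts; have /psumr_eq0P := q0 => /(_ _)/(_ s ts) H.
apply/eqP; rewrite -sqrf_eq0; apply/eqP/H => k _; exact: sqr_ge0.
Qed.

Lemma big_ord_split (V : zmodType) (P : pred nat) (a : 'I_t1.+1 -> V) :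
  (forall s, (t0 < s)%N -> P s) ->
  \sum_(s < t1.+1 | P s) a s =
  \sum_(s < t0.+1 | P s) a (widen_ord le01 s) + \sum_(s < t1.+1 | (t0 < s)%N) a s.
Proof.
move=> tP; rewrite (bigID (fun s : 'I_t1.+1 => (s < t0.+1)%N))/=; congr +%R.
  exact: (@big_ord_narrow_cond _ _ _ t0.+1 t1.+1 (fun s => P s) a le01).
apply: eq_bigl => s; rewrite -leqNgt.
by case: (boolP (t0 < s)%N) => [/tP ->|]; rewrite ?andbF.
Qed.

End Contract.

(** * Comparison of the stems [F] and [Ft] *)

Section Mirror.
Variables (R : realType) (A : falgType R) (conj : A -> A) (N : nat) (v : nat -> A).
Hypothesis bh : basis_hyp conj N v.
Variables (t0 n : nat) (t : nat -> nat).
Hypotheses (tE : t 0%N = t0) (tS : forall i, (i < n.+1)%N -> (t i < t i.+1)%N)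
  (tN : t n.+1 = N).
Variable D : set 'rV[R]_(t0.+1 + n.+1).
Hypotheses (oD : open D) (rD : refl_inv D).
Variables (p : regularity) (F : {set 'I_n.+1} -> 'rV[R]_(t0.+1 + n.+1) -> A) (f : A -> A).
Hypotheses (srF : stem_reg p D F) (iF : induces v t D F f).
Implicit Types (w : 'rV[R]_((t 1%N).+1 + n)) (K : {set 'I_n}) (J : 'I_n -> A).

Let t01 : (t0 < t 1)%N. Proof. by rewrite -tE; exact: tS. Qed.
Let t1N : (t 1 <= N)%N. Proof. by rewrite -tN; apply: (steps_le tS); rewrite leqnn. Qed.
Let b1 : 'I_(t0.+1 + n.+1) := rshift t0.+1 ord0.
Local Notation ctr := (@contractD R t0 (t 1) n.+1 n).
Local Notation G := (quot_stem F).
Local Notation rho w := (Num.sqrt (nsq t0 w)).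
Local Notation x1 w := (xone v t0 w).

Let srG : stem_reg p D G := quot_stem_reg oD srF.

Lemma nsq_nat w : nsq t0 w = \sum_(t0.+1 <= s < (t 1).+1) alpha_ext w s ^+ 2.
Proof.
rewrite (big_nat_widen_ord _ _ (leqnn _)) /nsq big_mkcond; apply: eq_bigr => s _.
have -> : (t0 < s <= t 1)%N = (t0 < s)%N by rewrite -[(s <= _)%N]ltnS ltn_ord andbT.
by rewrite /alpha_ext valK.
Qed.

Lemma xone_nat w : x1 w = \sum_(t0.+1 <= s < (t 1).+1) alpha_ext w s *: v s.
Proof.
rewrite (big_nat_widen_ord _ _ (leqnn _)) /xone big_mkcond; apply: eq_bigr => s _.
have -> : (t0 < s <= t 1)%N = (t0 < s)%N by rewrite -[(s <= _)%N]ltnS ltn_ord andbT.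
by rewrite /alpha_ext valK.
Qed.

Lemma sphere_dir w : exists2 J1 : A, inSph v t0.+1 (t 1) J1 & rho w *: J1 = x1 w.
Proof.
have [q0|q0] := eqVneq (nsq t0 w) 0.
  (* With [x1 = 0] any unit of the block serves; [t0 < t 1] ensures that the block has one. *)
  exists (v t0.+1).
    exists (fun s => (s == t0.+1)%:R); split.
      rewrite big_ltn// eqxx scale1r big_nat big1 ?addr0// => s /andP[ts _].
      by rewrite gtn_eqF// scale0r.
    rewrite big_ltn// eqxx expr1n big_nat big1 ?addr0// => s /andP[ts _].
    by rewrite gtn_eqF// expr0n.
  rewrite q0 sqrtr0 scale0r /xone big1// => s ts.
  by rewrite (nsq_eq0 q0)// scale0r.
have qp : 0 < nsq t0 w by rewrite lt_def q0 nsq_ge0.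
have r0 : rho w != 0 by rewrite gt_eqF// sqrtr_gt0.
exists ((rho w)^-1 *: x1 w); last by rewrite scalerA divff// scale1r.
exists (fun s => (rho w)^-1 * alpha_ext w s); split.
  by rewrite xone_nat scaler_sumr; apply: eq_bigr => s _; rewrite scalerA.
under eq_bigr do rewrite exprMn.
by rewrite -mulr_sumr -nsq_nat exprVn sqr_sqrtr ?nsq_ge0// mulVf.
Qed.

Definition Jcons (J1 : A) J : 'I_n.+1 -> A :=
  fun h => if unlift ord0 h is Some k then J k else J1.

Lemma Jcons0 (J1 : A) J : Jcons J1 J ord0 = J1.
Proof. by rewrite /Jcons unlift_none. Qed.

Lemma JconsS (J1 : A) J : (fun h => Jcons J1 J (lift ord0 h)) = J.
Proof. by apply/funext => h; rewrite /Jcons liftK. Qed.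

Lemma torus_Jcons (J1 : A) J : inSph v t0.+1 (t 1) J1 -> torus v (fun i => t i.+1) J ->
  torus v t (Jcons J1 J).
Proof.
move=> S1 TJ; apply: ord_case => [|h]; first by rewrite Jcons0 /= tE.
by rewrite /Jcons liftK lift0; exact: TJ.
Qed.

Lemma pt_contract w (J1 : A) J : rho w *: J1 = x1 w ->
  pt v (ctr w) (Jcons J1 J) = pt v w J.
Proof.
move=> e; rewrite /pt [X in _ + X = _]big_ord_recl Jcons0 /beta_c.
rewrite -/b1 (contract_beta0 t0) e /alpha_c (big_ord_split t01 (P := xpredT))// -addrA.
congr (_ + (_ + _)).
  by apply: eq_bigr => s _; rewrite (contract_alpha t01).
apply: eq_bigr => h _; rewrite -/(blift t0 h) contract_betaS.
by rewrite /Jcons liftK.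
Qed.

Lemma Jcons_anticomm (J1 : A) J h : inSph v t0.+1 (t 1) J1 ->
  torus v (fun i => t i.+1) J -> J1 * J h = - (J h * J1).
Proof.
move=> S1 TJ; apply: (inSph_anticomm bh _ _ _ S1 (TJ h)) => //.
  by rewrite ltnS; apply: (steps_le tS); rewrite /= ltnS ltnW.
by rewrite -tN; apply: (steps_le tS); rewrite /= leqnn andbT; exact: ltn_ord.
Qed.

Lemma tail_sqr J h : torus v (fun i => t i.+1) J -> J h * J h = -1.
Proof.
move=> TJ; apply: (inSph_sqr bh _ _ (TJ h)) => //.
by rewrite -tN; apply: (steps_le tS); rewrite /= leqnn andbT; exact: ltn_ord.
Qed.

(** Moving [J1] to the right of the other units brings the value of a [T]-function to a sum over [K]
    with the same left factors [JK J K] as that of a function for the larger mirror. The sign counts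
    the units passed. *)
Lemma IF_at_Jcons (J1 : A) J (H : {set 'I_n.+1} -> 'rV[R]_(t0.+1 + n.+1) -> A) u :
  inSph v t0.+1 (t 1) J1 -> torus v (fun i => t i.+1) J ->
  IF_at (Jcons J1 J) H u =
  \sum_K JK J K * (H (emb K) u + (-1) ^+ #|K| *: (J1 * H (ext K) u)).
Proof.
move=> S1 TJ; rewrite /IF_at big_set_split -big_split/=; apply: eq_bigr => K _.
rewrite JK_emb JK_ext JconsS Jcons0 mulrDr; congr +%R.
rewrite (JK_anticomm _ (fun h => Jcons_anticomm h S1 TJ)) -scalerAl -scalerAr.
by rewrite mulrA.
Qed.

Variable Ft : {set 'I_n} -> 'rV[R]_((t 1%N).+1 + n) -> A.
Hypothesis iFt : induces v (fun i => t i.+1) (@tildeD R t0 (t 1) n.+1 n D) Ft f.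
Variables (w : 'rV[R]_((t 1%N).+1 + n)) (J' : 'I_n -> A).
Hypotheses (Dw : D (ctr w)) (TJ' : torus v (fun i => t i.+1) J').

Lemma mirror_stemE K w1 : D (ctr w1) ->
  Ft K w1 = F (emb K) (ctr w1) + (-1) ^+ #|K| *: (x1 w1 * G (emb K) (ctr w1)).
Proof.
move=> D1; have [J1 S1 e1] := sphere_dir w1; apply/eqP; rewrite -subr_eq0; apply/eqP.
(* Changing signs in [J'] stays on the torus and leaves [J1] and the contracted point unchanged, so
   the two expressions of [f] agree for every choice of signs. *)
move: K; apply: (@JK_separates _ _ _ J'); first by move=> h; exact: tail_sqr.
move=> e; pose J h := (-1) ^+ e h *: J' h.
have TJ : torus v (fun i => t i.+1) J.
  move=> h; rewrite /J; case: (e h); rewrite ?expr1 ?scaleN1r ?expr0 ?scale1r//.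
  exact: inSphN.
have := iFt D1 TJ; rewrite -(pt_contract J e1) (iF D1 (torus_Jcons S1 TJ)).
rewrite IF_at_Jcons// => E; under eq_bigr do rewrite mulrBr.
apply/eqP; rewrite sumrB subr_eq0 -/J -/(IF_at J Ft w1) -E; apply/eqP/eq_bigr => K _.
congr (_ * (_ + _ *: _)); rewrite -e1 -(quot_stemM srF)// -/b1 (contract_beta0 t0).
by rewrite -scalerAl -scalerAr.
Qed.

Let u := ctr w.
Let ub1 : u 0 b1 = rho w. Proof. exact: contract_beta0. Qed.

Lemma quot_stem_pderiv K i : i != b1 ->
  u 0 b1 *: pderivA i (G (emb K)) u = pderivA i (F (ext K)) u.
Proof.
move=> ib; apply/esym/aderive_pderivA.
apply: near_eq_aderive (aderiveZc (u 0 b1) (pderivA_aderive i (srG.2 _) Dw)).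
have := near_line i oD Dw (@cvg_id _ _); apply: filterS => r Dr.
rewrite -(quot_stemM srF)// line_coord eq_sym (negPf ib) mulr0 add0r.
by [].
Qed.

(** The product rule for [beta_1 G]. The undifferentiated [G] is what later lowers the number of
    copies of [G] from [t1 - t0] to [t1 - t0 - 1]. *)
Lemma quot_stem_pderiv1 K : pderivA b1 (F (ext K)) u =
  G (emb K) u + u 0 b1 *: pderivA b1 (G (emb K)) u.
Proof.
have d1 : is_derive (0 : R) (1 : R) (fun r => r + u 0 b1) 1.
  have := is_deriveD (is_derive_id (0 : R) (1 : R)) (is_derive_cst (u 0 b1) (0 : R) (1 : R)).
  by rewrite addr0.
have := aderiveZ d1 (pderivA_aderive b1 (srG.2 (emb K)) Dw).
rewrite add0r scale0r add0r scale1r addrC => d; apply: aderive_pderivA.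
apply: near_eq_aderive d.
have := near_line b1 oD Dw (@cvg_id _ _); apply: filterS => r Dr.
by rewrite -(quot_stemM srF)// line_coord eqxx mulr1.
Qed.

Let bflip_u : u 0 b1 = 0 -> bflip ord0 u = u.
Proof.
move=> u0; apply/rowP => j; rewrite bflipE; case: eqP => [->|_]; last by rewrite mul1r.
by rewrite -/b1 u0 mulr0.
Qed.

Lemma even_pderiv1 K : u 0 b1 = 0 -> pderivA b1 (F (emb K)) u = 0.
Proof.
move=> u0; have := pderivA_bflip oD ord0 b1 srF.1 (srF.2 (emb K)) Dw.
rewrite (bflip_u u0) eqxx in_emb0 expr1 expr0 scale1r scaleN1r => /eqP.
by rewrite -addr_eq0 -mulr2n -scaler_nat scaler_eq0 pnatr_eq0/= => /eqP.
Qed.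

Lemma even_line K (H : {set 'I_n.+1} -> 'rV[R]_(t0.+1 + n.+1) -> A) (r : R) :
  is_stem D H -> u 0 b1 = 0 -> D (r *: evec R b1 + u) ->
  D (`|r| *: evec R b1 + u) /\
  H (emb K) (`|r| *: evec R b1 + u) = H (emb K) (r *: evec R b1 + u).
Proof.
move=> /is_stemE sH u0 Dr; have [r0|r0] := ger0P r; first by [].
have -> : - r *: evec R b1 + u = bflip ord0 (r *: evec R b1 + u).
  by rewrite bflip_line eqxx expr1 mulN1r bflip_u.
by split; [exact: rD|rewrite sH// in_emb0 expr0 scale1r].
Qed.

Variable (J1 : A).
Hypotheses (S1 : inSph v t0.+1 (t 1) J1) (e1 : rho w *: J1 = x1 w).

(** Directions that leave [x1] fixed: [x1 G] differentiates only through [G], and [x1 = rho J1]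
    turns [rho] times the derivative of [G] back into that of [F (ext K)]. *)
Lemma mirror_pderiv_flat K i i' : i' != b1 ->
  (forall r, ctr (r *: evec R i + w) = r *: evec R i' + u) ->
  (forall r, x1 (r *: evec R i + w) = x1 w) ->
  pderivA i (Ft K) w = pderivA i' (F (emb K)) u +
    (-1) ^+ #|K| *: (J1 * pderivA i' (F (ext K)) u).
Proof.
move=> ib ec ex; rewrite -quot_stem_pderiv// ub1 -scalerAr scalerAl e1.
apply: aderive_pderivA.
apply: near_eq_aderive (aderiveD (pderivA_aderive i' (srF.2 _) Dw)
  (aderiveZc ((-1) ^+ #|K|) (aderiveM (x1 w) (pderivA_aderive i' (srG.2 _) Dw)))).
have := near_line i' oD Dw (@cvg_id _ _); apply: filterS => r Dr.
by rewrite mirror_stemE ?ec// ex.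
Qed.

Lemma mirror_pderiv_alpha K s : pderivA (alift n t01 s) (Ft K) w =
  pderivA (lshift n.+1 s) (F (emb K)) u +
    (-1) ^+ #|K| *: (J1 * pderivA (lshift n.+1 s) (F (ext K)) u).
Proof.
apply: mirror_pderiv_flat => [|r|r]; first by rewrite eq_lrshift.
  exact: contract_line_alpha.
exact: xone_line_alpha.
Qed.

Lemma mirror_pderiv_beta K h : pderivA (rshift (t 1).+1 h) (Ft K) w =
  pderivA (blift t0 h) (F (emb K)) u +
    (-1) ^+ #|K| *: (J1 * pderivA (blift t0 h) (F (ext K)) u).
Proof.
apply: mirror_pderiv_flat => [|r|r]; first by rewrite eq_rshift lift_eqF.
  exact: contract_line_beta.
exact: xone_line_beta.
Qed.

Lemma mirror_pderiv_radial K (s : 'I_(t 1).+1) : (t0 < s)%N ->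
  pderivA (lshift n s) (Ft K) w =
  (w 0 (lshift n s) / rho w) *: pderivA b1 (F (emb K)) u +
  (-1) ^+ #|K| *: (x1 w * ((w 0 (lshift n s) / rho w) *: pderivA b1 (G (emb K)) u) +
                   v s * G (emb K) u).
Proof.
(* Off [x1 = 0] this is the partial derivative of [|x1|]; on [x1 = 0] the convention [0^-1 = 0]
   makes it 0. *)
move=> ts; set d := w 0 (lshift n s) / rho w.
pose sh (r : R) := Num.sqrt (nsq t0 w + 2 * r * w 0 (lshift n s) + r ^+ 2) - rho w.
(* The true increment [sh] of [beta_1] may fail to be differentiable at 0. It is traded for a
   differentiable [del] giving the same values of [F] and [G], whose speed [d'] has to match [d]
   only on the terms it multiplies. *)
suff [del [d' [ddel del0 eP eQ delE]]] : exists (del : R -> R) (d' : R), [/\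
   is_derive (0 : R) (1 : R) del d', del 0 = 0,
   d' *: pderivA b1 (F (emb K)) u = d *: pderivA b1 (F (emb K)) u,
   x1 w * (d' *: pderivA b1 (G (emb K)) u) = x1 w * (d *: pderivA b1 (G (emb K)) u) &
   forall r, D (del r *: evec R b1 + u) ->
     [/\ D (sh r *: evec R b1 + u),
      F (emb K) (sh r *: evec R b1 + u) = F (emb K) (del r *: evec R b1 + u) &
      G (emb K) (sh r *: evec R b1 + u) = G (emb K) (del r *: evec R b1 + u)]].
  have dF := aderive_comp ddel del0 (pderivA_aderive b1 (srF.2 (emb K)) Dw).
  have dG := aderive_comp ddel del0 (pderivA_aderive b1 (srG.2 (emb K)) Dw).
  have dG' := aderiveM (v s) (aderiveZ (is_derive_id (0 : R) (1 : R)) dG).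
  have := aderiveD dF (aderiveZc ((-1) ^+ #|K|) (aderiveD (aderiveM (x1 w) dG) dG')).
  rewrite del0 !scale0r !add0r scale1r eP eQ => dd; apply: aderive_pderivA.
  apply: near_eq_aderive dd.
  have dc : del @ (0 : R) --> (0 : R).
    rewrite -{2}del0; apply: differentiable_continuous.
    by apply/derivable1_diffP; case: ddel.
  have := near_line b1 oD Dw dc; apply: filterS => r /delE[Ds Fs Gs].
  rewrite mirror_stemE (contract_line t01 ts)// -/(sh r) -/u (xone_line v ts) Fs Gs.
  congr (_ + _ *: _); rewrite mulrDl; congr +%R.
  by rewrite -scalerAl -scalerAr.
have [q0|q0] := eqVneq (nsq t0 w) 0.
  have ws := nsq_eq0 q0 ts; have r0 : rho w = 0 by rewrite q0 sqrtr0.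
  have u0 : u 0 b1 = 0 by rewrite ub1.
  have shE r : sh r = `|r| by rewrite /sh r0 q0 ws mulr0 !add0r subr0 sqrtr_sqr.
  (* Here [sh r = |r|], which evenness replaces by [r]. The speed 1 is not [d = 0], but it meets a
     vanishing derivative of [F] and a factor [x1 = 0]. *)
  exists id, 1; split => //.
  - exact: is_derive_id.
  - by rewrite even_pderiv1// !scaler0.
  - by rewrite -e1 r0 scale0r !mul0r.
  - move=> r Dr; rewrite shE.
    by have [? ?] := even_line K srF.1 u0 Dr; have [_ ?] := even_line K srG.1 u0 Dr.
have qp : 0 < nsq t0 w by rewrite lt_def q0 nsq_ge0.
exists sh, d; split => //; last by rewrite /sh mulr0 mul0r addr0 expr0n addr0 subrr.
pose g (r : R) := nsq t0 w + 2 * r * w 0 (lshift n s) + r ^+ 2.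
have g0 : g 0 = nsq t0 w by rewrite /g mulr0 mul0r addr0 expr0n addr0.
have dg : is_derive (0 : R) (1 : R) g (2 * w 0 (lshift n s)).
  have -> : g = cst (nsq t0 w) + (2 * w 0 (lshift n s)) *: id + id * id.
    by apply/funext => r; rewrite /g !fctE /= /GRing.scale/=; ring.
  have did := is_derive_id (0 : R) (1 : R).
  have := is_deriveD (is_deriveD (is_derive_cst (nsq t0 w) (0 : R) (1 : R))
    (is_deriveZ (2 * w 0 (lshift n s)) did)) (is_deriveM did did).
  by rewrite !scale0r !addr0 add0r [_ *: 1]mulr1.
have dsq : is_derive (g 0) (1 : R) (@Num.sqrt R) (2 * rho w)^-1 by rewrite g0; exact: is_derive1_sqrt.
have := is_deriveB (is_derive1_comp dsq dg) (is_derive_cst (rho w) (0 : R) (1 : R)).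
rewrite subr0 => H; apply: is_derive_eq H _; rewrite /d.
have r0 : rho w != 0 by rewrite gt_eqF// sqrtr_gt0.
by field.
Qed.

Let J1sqr : J1 * J1 = -1. Proof. exact: (inSph_sqr bh _ t1N S1). Qed.

Lemma mirror_pderiv_radial_sum K :
  \sum_(s < (t 1).+1 | (t0 < s)%N) v s * pderivA (lshift n s) (Ft K) w =
  J1 * pderivA b1 (F (emb K)) u - (-1) ^+ #|K| *: pderivA b1 (F (ext K)) u
  - ((-1) ^+ #|K| * ((t 1)%:R - (1 + t0)%:R)) *: G (emb K) u.
Proof.
set P := pderivA b1 (F (emb K)) u; set Q := pderivA b1 (G (emb K)) u.
set e : R := (-1) ^+ #|K|; set g := G (emb K) u.
(* This and [QE] hold at [rho w = 0] too: there [P] is 0 by evenness, and both sides of [QE] are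
   0. *)
have PE : (rho w)^-1 *: (x1 w * P) = J1 * P.
  have [r0|r0] := eqVneq (rho w) 0.
    by rewrite /P even_pderiv1 ?ub1// !mulr0 scaler0.
  by rewrite -e1 -scalerAl scalerA mulVf// scale1r.
have QE : (rho w)^-1 *: (x1 w * (x1 w * Q)) = - (rho w *: Q).
  have xx : x1 w * x1 w = (- rho w ^+ 2) *: 1.
    by rewrite -e1 -scalerAl -scalerAr J1sqr scalerA scalerN scaleNr.
  rewrite mulrA xx -scalerAl mul1r scalerA -[RHS]scaleNr; congr (_ *: _).
  have [->|r0] := eqVneq (rho w) 0; first by rewrite invr0 mul0r oppr0.
  by rewrite mulrN expr2 mulKf.
have term (s : 'I_(t 1).+1) : (t0 < s)%N -> v s * pderivA (lshift n s) (Ft K) w =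
    (rho w)^-1 *: ((w 0 (lshift n s) *: v s) * P) +
    e *: ((rho w)^-1 *: ((w 0 (lshift n s) *: v s) * (x1 w * Q))) - e *: g.
  move=> ts; rewrite mirror_pderiv_radial// -/P -/Q -/g -/e.
  have vv : v s * v s = -1.
    apply: (unit_sqr bh); rewrite (leq_trans _ ts)//= (leq_trans _ t1N)//.
    by rewrite -ltnS.
  rewrite mulrDr -addrA; congr +%R.
    by rewrite -scalerAr -scalerAl scalerA mulrC.
  rewrite -scalerAr mulrDr scalerDr [v s * (v s * g)]mulrA vv mulN1r scalerN; congr (_ - _).
  congr (_ *: _); rewrite -!scalerAr -scalerAl [RHS]scalerA.
  by rewrite [_^-1 * _]mulrC.
rewrite (eq_bigr _ term) sumrB big_split/= -!scaler_sumr -!mulr_suml -/(x1 w) PE QE.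
have -> : \sum_(s < (t 1).+1 | (t0 < s)%N) g = ((t 1)%:R - t0%:R : R) *: g.
  have := @big_nat_widen_ord (t 1) A (fun=> g) t0.+1 (t 1) (leqnn _).
  rewrite sumr_const_nat subSS -scaler_nat natrB ?(ltnW t01)// => ->.
  rewrite big_mkcond; apply: eq_bigr => s _.
  by rewrite -[(s <= _)%N]ltnS ltn_ord andbT.
(* So far [v_s v_s = -1] has given one copy of [g] for each of the [t1 - t0] directions; trading
   [rho *: Q] for the derivative of [F (ext K)] gives one back. *)
rewrite quot_stem_pderiv1 ub1 -/Q -/g natrD.
move: (J1 * P) (Q) (g) (rho w) (e) (t 1)%:R t0%:R => a b c d' e' q q'.
apply: acoord_inj => j; rewrite !(acoordD, acoordN, acoordZ).
by ring.
Qed.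

Lemma signrZ k (x : A) : (-1) ^+ k * x = ((-1) ^+ k : R) *: x.
Proof.
rewrite -signr_odd -[in RHS]signr_odd.
by case: (odd k); rewrite ?expr1 ?expr0 ?mulN1r ?scaleN1r ?mul1r ?scale1r.
Qed.

Lemma dbarTE m k (H : {set 'I_k} -> 'rV[R]_(m.+1 + k) -> A) L y : dbarT v H L y =
  pderivA (lshift k ord0) (H L) y +
  ((-1) ^+ #|L| : R) *: (\sum_(s < m.+1 | (0 < s)%N) v s * pderivA (lshift k s) (H L) y) +
  \sum_(h < k) ((-1) ^+ (sigma_par h L).+1 : R) *:
     pderivA (rshift m.+1 h) (H (symdiff1 L h)) y.
Proof.
rewrite /dbarT /dalpha; congr +%R; last by apply: eq_bigr => h _; rewrite signrZ.
by rewrite signrZ exprS mulN1r scaleNr opprK.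
Qed.

(** The operator weights the sum over the [v_s] by [(-1)^|K|], the very sign that [G] carries in the
    radial sum; their product is 1. The radial terms [J1 * P] and the derivative of [F (ext K)]
    become the [h = ord0] terms of the components [ext K] and [emb K]. *)
Lemma mirror_dbarT K : dbarT v Ft K w =
  dbarT v F (emb K) u + (-1) ^+ #|K| *: (J1 * dbarT v F (ext K) u)
  + ((1 + t0)%:R - (t 1)%:R : R) *: G (emb K) u.
Proof.
rewrite !dbarTE (big_ord_split t01 (P := fun s => (0 < s)%N)); last by move=> s; lia.
rewrite mirror_pderiv_radial_sum.
have -> : lshift n ord0 = alift n t01 ord0 by congr lshift; exact/val_inj.
rewrite mirror_pderiv_alpha.
(* Each [v_s] with [1 <= s <= t0] anticommutes with [J1]; this minus sign is the one that separates
   [#|ext K|] from [#|K|] in the operator. *)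
have aE : \sum_(s < t0.+1 | (0 < s)%N) v (widen_ord (ltnW t01 : (t0.+1 <= (t 1).+1)%N) s) *
      pderivA (lshift n (widen_ord (ltnW t01 : (t0.+1 <= (t 1).+1)%N) s)) (Ft K) w =
    \sum_(s < t0.+1 | (0 < s)%N) v s * pderivA (lshift n.+1 s) (F (emb K)) u -
    (-1) ^+ #|K| *: (J1 * \sum_(s < t0.+1 | (0 < s)%N) v s *
       pderivA (lshift n.+1 s) (F (ext K)) u).
  rewrite mulr_sumr scaler_sumr -sumrB; apply: eq_bigr => s s0.
  have := mirror_pderiv_alpha K s; rewrite /alift => ->.
  rewrite mulrDr; congr +%R; rewrite -scalerAr -scalerN; congr (_ *: _).
  rewrite !mulrA -mulNr; congr (_ * _).
  by rewrite (unit_inSph_anticomm bh _ _ t1N S1) ?opprK//= ltnS -ltnS.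
rewrite aE !big_ord_recl sigma_par_emb0 sigma_par_ext0 symdiff1_emb0 symdiff1_ext0 -/b1.
have bE : \sum_(h < n) ((-1) ^+ (sigma_par h K).+1 : R) *:
      pderivA (rshift (t 1).+1 h) (Ft (symdiff1 K h)) w =
    \sum_(h < n) ((-1) ^+ (sigma_par (lift ord0 h) (emb K)).+1 : R) *:
      pderivA (rshift t0.+1 (lift ord0 h)) (F (symdiff1 (emb K) (lift ord0 h))) u +
    (-1) ^+ #|K| *: (J1 *
    \sum_(h < n) ((-1) ^+ (sigma_par (lift ord0 h) (ext K)).+1 : R) *:
      pderivA (rshift t0.+1 (lift ord0 h)) (F (symdiff1 (ext K) (lift ord0 h))) u).
  rewrite mulr_sumr scaler_sumr -big_split/=; apply: eq_bigr => h _.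
  rewrite sigma_par_emb sigma_par_ext symdiff1_emb symdiff1_ext.
  rewrite mirror_pderiv_beta scalerDr; congr +%R.
  rewrite -scalerAr !scalerA; congr (_ *: _).
  (* Two sign changes cancel: removing or adding [h] alters the parity of [K], and the element
     [ord0] of [ext K] raises [sigma_par] by one. *)
  by rewrite -[(-1) ^+ #|symdiff1 K h|]signr_odd card_symdiff1 signrN signr_odd !exprS; ring.
rewrite bE card_emb card_ext.
set e : R := (-1) ^+ #|K|.
have : e = 1 \/ e = -1.
  by rewrite /e -signr_odd; case: (odd _); [right; rewrite expr1|left; rewrite expr0].
rewrite !mulrDr -!scalerAr (exprS _ #|K|) -/e sqrrN expr1n expr1 natrD.
set a1 := pderivA _ _ _; set a2 := J1 * _; set a3 := \sum_(s | _) _ .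
set a4 := J1 * _; set a5 := J1 * _; set a6 := pderivA _ _ _; set a7 := G _ _.
set a8 := \sum_(h < n) _; set a9 := J1 * _.
move: a1 a2 a3 a4 a5 a6 a7 a8 a9 e (t 1)%:R t0%:R.
move=> a1 a2 a3 a4 a5 a6 a7 a8 a9 e q q' [] ->.
  by apply: acoord_inj => j; rewrite !(acoordD, acoordN, acoordZ); ring.
by apply: acoord_inj => j; rewrite !(acoordD, acoordN, acoordZ); ring.
Qed.

Lemma mirror_pderiv0 K : pderivA (lshift n ord0) (Ft K) w =
  pderivA (lshift n.+1 ord0) (F (emb K)) u +
    (-1) ^+ #|K| *: (J1 * pderivA (lshift n.+1 ord0) (F (ext K)) u).
Proof.
have -> : lshift n ord0 = alift n t01 ord0 by congr lshift; exact/val_inj.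
exact: mirror_pderiv_alpha.
Qed.

Lemma IF_at_quot_stem : IF_at (Jcons J1 J') G u = \sum_K JK J' K * G (emb K) u.
Proof.
rewrite IF_at_Jcons//; apply: eq_bigr => K _; congr (_ * _).
by rewrite {2}/quot_stem in_ext0 mulr0 scaler0 addr0.
Qed.

Lemma IF_at_mirror_dbarT : IF_at J' (dbarT v Ft) w =
  IF_at (Jcons J1 J') (dbarT v F) u +
  ((1 + t0)%:R - (t 1)%:R : R) *: IF_at (Jcons J1 J') G u.
Proof.
rewrite IF_at_quot_stem IF_at_Jcons// scaler_sumr -big_split/=; apply: eq_bigr => K _.
by rewrite mirror_dbarT mulrDr; congr +%R; rewrite scalerAr.
Qed.

Lemma IF_at_mirror_pderiv0 :
  IF_at J' (fun K => pderivA (lshift n ord0) (Ft K)) w =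
  IF_at (Jcons J1 J') (fun L : {set 'I_n.+1} => pderivA (lshift n.+1 ord0) (F L)) u.
Proof. by rewrite IF_at_Jcons//; apply: eq_bigr => K _; rewrite mirror_pderiv0. Qed.

End Mirror.

Lemma IF_at_dT (R : realType) (A : falgType R) (v : nat -> A) m k
    (H : {set 'I_k} -> 'rV[R]_(m.+1 + k) -> A) J y :
  IF_at J (dT v H) y = 2%:R *: IF_at J (fun K => pderivA (lshift k ord0) (H K)) y -
    IF_at J (dbarT v H) y.
Proof.
rewrite /IF_at scaler_sumr -sumrB; apply: eq_bigr => K _.
by rewrite dTE mulrBr scalerAr.
Qed.

Theorem theorem5p3 (R : realType) (A : falgType R) (conj : A -> A)
  (N : nat) (v : nat -> A) (t0 tau : nat) (t : nat -> nat)
  (D : set 'rV[R]_(t0.+1 + tau)) (p : regularity)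
  (F : {set 'I_tau} -> 'rV[R]_(t0.+1 + tau) -> A) (f : A -> A) :
  star_involution conj ->
  (1 <= N)%N ->
  basis_hyp conj N v ->
  (1 <= tau)%N ->
  t 0%N = t0 -> (forall i, (i < tau)%N -> (t i < t i.+1)%N) -> t tau = N ->
  open D -> refl_inv D ->
  stem_reg p D F -> induces v t D F f ->
  exists G : {set 'I_tau} -> 'rV[R]_(t0.+1 + tau) -> A,
    stem_reg p D G /\
    (forall (K : {set 'I_tau}) (h1 : 'I_tau) (w : 'rV[R]_(t0.+1 + tau)),
       (h1 : nat) = 0%N -> D w -> beta_c w h1 != 0 ->
       G K w = if h1 \in K then 0 else (beta_c w h1)^-1 *: F (h1 |: K) w) /\
    (forall Ft : {set 'I_tau.-1} -> 'rV[R]_((t 1%N).+1 + tau.-1) -> A,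
       stem_reg p (@tildeD R t0 (t 1%N) tau tau.-1 D) Ft ->
       induces v (fun i => t i.+1) (@tildeD R t0 (t 1%N) tau tau.-1 D) Ft f ->
       forall (w : 'rV[R]_(t0.+1 + tau)) (J : 'I_tau -> A)
              (w' : 'rV[R]_((t 1%N).+1 + tau.-1)) (J' : 'I_tau.-1 -> A),
         D w -> torus v t J ->
         @tildeD R t0 (t 1%N) tau tau.-1 D w' -> torus v (fun i => t i.+1) J' ->
         pt v w J = pt v w' J' ->
         IF_at J' (dbarT v Ft) w'
           = IF_at J (dbarT v F) w + ((1 + t0)%:R - (t 1%N)%:R : R) *: IF_at J G w
         /\
         IF_at J' (dT v Ft) w'
           = IF_at J (dT v F) w + ((t 1%N)%:R - (1 + t0)%:R : R) *: IF_at J G w).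
Proof.
move=> _ _ bh; case: tau D F => // n D F _ tE tS tN oD rD srF iF.
exists (quot_stem F); split; first exact: quot_stem_reg.
split=> [K h1 w h10 _ b0|].
  have h1E : h1 = ord0 by exact/val_inj.
  rewrite h1E in b0 *; rewrite /quot_stem; case: ifP => // _.
  by rewrite -/(beta_c w ord0) (negPf b0).
move=> Ft _ iFt w J w' J' Dw TJ Dw' TJ' ptE.
rewrite /= in Ft iFt w' J' Dw' TJ' ptE *; pose u := @contractD R t0 (t 1) n.+1 n w'.
have [J1 S1 e1] := sphere_dir v tE tS w'.
have TJ0 := torus_Jcons tE S1 TJ'.
have ptE0 : pt v w J = pt v u (Jcons J1 J').
  by rewrite (pt_contract tE tS _ e1).
have [ae be] := pt_inj bh tE tS tN TJ TJ0 ptE0.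
(* The given [(w, J)] and the canonical [(u, Jcons J1 J')] represent one point but may differ by
   reflections, and arbitrarily where some [beta_h] vanishes; for a stem the value is the same. *)
have wd H : is_stem D H -> IF_at (Jcons J1 J') H u = IF_at J H w.
  move=> sH; apply/esym; apply: (stem_well_defined rD sH Dw Dw') => // h.
    exact: (torus_sqr bh tS tN).
  exact: (torus_sqr bh tS tN).
have dbE := IF_at_mirror_dbarT bh tE tS tN oD rD srF iF iFt Dw' TJ' S1 e1.
have dbE' : IF_at J' (dbarT v Ft) w' = IF_at J (dbarT v F) w +
    ((1 + t0)%:R - (t 1%N)%:R : R) *: IF_at J (quot_stem F) w.
  rewrite dbE (wd _ (is_stem_dbarT oD v srF)) (wd _ (quot_stem_is_stem oD srF)).
  by [].
split => //; rewrite !IF_at_dT dbE'.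
(* The [alpha_0]-derivative passes to the larger mirror without correction, so subtracting [dbarT]
   from its double reverses the sign of the coefficient of [G]. *)
have := IF_at_mirror_pderiv0 bh tE tS tN oD srF iF iFt Dw' TJ' S1 e1.
rewrite /= (wd _ (is_stem_pderivA_alpha oD _ srF)) => ->.
by rewrite opprD addrA -scaleNr opprB.
Qed.
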